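(* Let $d\ge 2$ be an integer, let $p_1,\dots,p_s$ be distinct points of $\mathbb{P}^3$, let $m_1,\dots,m_s$ be positive integers, and let $Z:=\sum_{i=1}^s m_ip_i$. Assume that all of the following conditions hold: (1) $\mathrm{w}(Z)\le 3d+1$; (2) $\mathrm{w}_L(Z)\le d+1$ for each line $L\subset\mathbb{P}^3$; (3) for every plane $L\subset\mathbb{P}^3$ we have $\mathrm{w}_L(Z)\le 2d+2$, and if $\mathrm{w}_L(Z)=2d+2$ then $h^1(L,\mathcal{I}_{Z\cap L}(d))=0$. Then $h^1(\mathbb{P}^3,\mathcal{I}_Z(d))=0$.
   Context: $K$ is an algebraically closed field and $\mathbb{P}^3=\mathbb{P}^3_K$. For distinct points $p_1,\dots,p_s\in\mathbb{P}^3$ with homogeneous prime ideals $\mathfrak{p}_i\subset K[x_0,\dots,x_3]$, $\sum_{i=1}^s m_ip_i$ denotes the $0$-dimensional subscheme $Z$ of $\mathbb{P}^3$ defined by the saturated ideal $\mathfrak{p}_1^{m_1}\cap\cdots\cap\mathfrak{p}_s^{m_s}$, and $\mathcal{I}_Z$ its ideal sheaf. $\mathrm{w}(Z):=\sum_{i=1}^s m_i$ and, for $L\subseteq\mathbb{P}^3$, $\mathrm{w}_L(Z):=\sum_{i:\,p_i\in L}m_i$. In (3), $Z\cap L$ is the scheme-theoretic intersection and $\mathcal{I}_{Z\cap L}$ is its ideal sheaf in $\mathcal{O}_L$, with $L\cong\mathbb{P}^2$. *)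

(* Defs.v *)
From mathcomp Require Export all_boot all_order all_algebra.
From mathcomp Require Export mpoly.

Set Implicit Arguments.
Unset Strict Implicit.
Unset Printing Implicit Defensive.

Import GRing.Theory.

Local Open Scope ring_scope.

(* P^(n-1) is the set of 1-dimensional subspaces of K^n; lines and planes of
   projective space are subspaces of dimension 2 and 3.  Ideals are predicates
   on the homogeneous coordinate ring K[x_0, ..., x_(n-1)]. *)

(* The polynomials vanishing on every vector of P.  As K is infinite in the
   intended use, this is the homogeneous prime ideal of the point P. *)
Definition point_ideal (K : fieldType) (n : nat) (P : {vspace 'rV[K]_n})
    (f : {mpoly K[n]}) : Prop :=
  forall v : 'rV[K]_n, v \in P -> f.@[fun j => v 0 j] = 0.

Definition ideal_exp (R : comNzRingType) (I : R -> Prop) (m : nat) (f : R) :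
    Prop :=
  exists (N : nat) (a : 'I_N -> R) (g : 'I_N -> 'I_m -> R),
    (forall k j, I (g k j)) /\ f = \sum_(k < N) a k * \prod_(j < m) g k j.

Definition fat_ideal (K : fieldType) (n s : nat)
    (p : 'I_s -> {vspace 'rV[K]_n}) (m : 'I_s -> nat) (f : {mpoly K[n]}) :
    Prop :=
  forall i : 'I_s, ideal_exp (point_ideal (p i)) (m i) f.

Definition weight (s : nat) (m : 'I_s -> nat) : nat := (\sum_(i < s) m i)%N.

Definition weight_on (K : fieldType) (n s : nat)
    (p : 'I_s -> {vspace 'rV[K]_n}) (m : 'I_s -> nat)
    (L : {vspace 'rV[K]_n}) : nat :=
  (\sum_(i < s | (p i <= L)%VS) m i)%N.

(* The chosen basis of L identifies P(L) with P^(dim L - 1); the x_j restrict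
   to linear forms in the coordinates with respect to that basis. *)
Definition restrict_coord (K : fieldType) (n : nat) (L : {vspace 'rV[K]_n}) :
    n.-tuple {mpoly K[\dim L]} :=
  [tuple \sum_(i < \dim L) (tnth (vbasis L) i) 0 j *: 'X_i | j < n].

(* The image of I in the coordinate ring of P(L) defines the scheme-theoretic
   intersection with P(L) of the subscheme defined by I.  It need not be
   saturated, which does not affect the associated ideal sheaf. *)
Definition restrict_ideal (K : fieldType) (n : nat) (L : {vspace 'rV[K]_n})
    (I : {mpoly K[n]} -> Prop) (g : {mpoly K[\dim L]}) : Prop :=
  exists2 f, I f & g = f \mPo restrict_coord L.

(* Sections over the open set where all x_i, i in A, are nonzero, of the twist
   by d of the sheaf associated with the homogeneous ideal I: the degree-d part
   of the localization of I at the product of these x_i, inside the fraction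
   field of the polynomial ring. *)
Definition twist_section (K : fieldType) (n : nat) (I : {mpoly K[n]} -> Prop)
    (d : nat) (A : {set 'I_n}) (q : {fraction {mpoly K[n]}}) : Prop :=
  exists (k : nat) (f : {mpoly K[n]}),
    [/\ I f, f \is (d + k * #|A|).-homog
      & q = tofrac f / tofrac ((\prod_(i in A) 'X_i) ^+ k)].

(* H^1 of the twist by d of the sheaf associated with I, computed as Cech
   cohomology of the standard affine cover of P^(n-1), vanishes: every
   1-cocycle is a coboundary. *)
Definition H1_vanishes (K : fieldType) (n : nat) (I : {mpoly K[n]} -> Prop)
    (d : nat) : Prop :=
  forall c : 'I_n -> 'I_n -> {fraction {mpoly K[n]}},
    (forall i j, twist_section I d [set i; j] (c i j)) ->
    (forall i j k, c j k - c i k + c i j = 0) ->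
    exists2 b : 'I_n -> {fraction {mpoly K[n]}},
      forall i, twist_section I d [set i] (b i)
      & forall i j, c i j = b j - b i.

(* Main.v *)
(* Surjectivity of the degree-d forms onto the jets at the fat points is
   equivalent to the vanishing of H^1; it is shown by peeling off one point P at
   a time, as in Nagel and Trok's proof of Segre's bound.  If P has multiplicity
   k + 1, it suffices to find, for each product of k linear forms vanishing at
   P, a form of degree d = k + e in the ideal of the other points with that
   leading term at P.  Such a form is a combination of products of k planes
   through P and e planes avoiding P.  In the projection from P, the planes
   through P are chosen so that the remaining multiset of points has at most e
   points at each place, 2e on each line and 3e in all; by a rank-3 case of
   Edmonds' matroid partition theorem it then splits into e independent sets.

   This covers the case w_L <= 2d + 1 for all planes L.  If w_L = 2d + 2 for
   some L, the residual of Z with respect to L satisfies these bounds in degree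
   d - 1, and the hypothesis on L supplies interpolation on L itself. *)


(* The leading form at P is prescribed, so its linear factors cannot be chosen to suit the other
   points, and one good plane through P per step is not enough. Each step needs a family of
   subspaces through P, each lowering the weights far enough, such that every linear form vanishing
   at P is a sum of forms vanishing on members of the family. This is why up to three subspaces
   occur together.

   The bound 2d + 1 on planes is what the count tolerates: taking off the multiplicity k + 1 of P
   leaves 2e + k, and k planes through P, each lowering this by one, end at the 2e required by the
   partition. Starting from 2d + 2 one would end at 2e + 1.

   The cohomological steps are carried out by clearing denominators, which turns cocycles into
   identities between forms. The local input is always the same: a linear form that does not vanish
   at a point is a unit there, so it can be cancelled or divided out modulo a power of the ideal of
   the point. *)
From HB Require Import structures.
Require Import Defs.
From mathcomp Require Import ring zify.
From Stdlib Require Import Classical.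

Set Implicit Arguments.
Unset Strict Implicit.
Unset Printing Implicit Defensive.

Import GRing.Theory.

Local Open Scope ring_scope.

(** * Powers of the ideal of a point *)

Section IdealPowers.
Variables (R : comNzRingType) (I : R -> Prop).
Implicit Types (f g r : R) (m : nat).

Lemma ideal_exp_0 m : ideal_exp I m 0.
Proof.
exists 0, (fun=> 0), (fun k _ => 0); split; first by case.
by rewrite big_ord0.
Qed.

Lemma ideal_exp_D m f g : ideal_exp I m f -> ideal_exp I m g -> ideal_exp I m (f + g).
Proof.
move=> [N1 [a1 [g1 [Ig1 ->]]]] [N2 [a2 [g2 [Ig2 ->]]]].
exists (N1 + N2)%N,
  (fun k => match split k with inl i => a1 i | inr i => a2 i end),
  (fun k => match split k with inl i => g1 i | inr i => g2 i end).
split=> [k j|]; first by case: (split k).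
rewrite big_split_ord /=; congr (_ + _); apply: eq_bigr => i _.
  by rewrite (unsplitK (inl i)).
by rewrite (unsplitK (inr i)).
Qed.

Lemma ideal_exp_Ml m r f : ideal_exp I m f -> ideal_exp I m (r * f).
Proof.
move=> [N [a [g [Ig ->]]]]; exists N, (fun k => r * a k), g; split=> //.
by rewrite mulr_sumr; apply: eq_bigr => k _; rewrite mulrA.
Qed.

Lemma ideal_exp_N m f : ideal_exp I m f -> ideal_exp I m (- f).
Proof. by move=> /(ideal_exp_Ml (-1)); rewrite mulN1r. Qed.

Lemma ideal_exp_B m f g : ideal_exp I m f -> ideal_exp I m g -> ideal_exp I m (f - g).
Proof. by move=> If /ideal_exp_N; apply: ideal_exp_D. Qed.

Lemma ideal_exp_sum m (T : Type) (s : seq T) (P : pred T) (F : T -> R) :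
  (forall i, P i -> ideal_exp I m (F i)) -> ideal_exp I m (\sum_(i <- s | P i) F i).
Proof.
move=> IF; elim/big_rec: _ => [|i x Pi Ix]; first exact: ideal_exp_0.
exact: ideal_exp_D (IF i Pi) Ix.
Qed.

Lemma ideal_exp_exp0 f : ideal_exp I 0 f.
Proof.
exists 1%N, (fun=> f), (fun _ _ => 0); split; first by move=> k [].
by rewrite big_ord1 big_ord0 mulr1.
Qed.

Lemma ideal_exp_S m l f : I l -> ideal_exp I m f -> ideal_exp I m.+1 (l * f).
Proof.
move=> Il [N [a [g [Ig ->]]]].
exists N, a, (fun k j => oapp (g k) l (unlift ord0 j)); split=> [k j|].
  by case: (unlift ord0 j) => [o|] /=.
rewrite mulr_sumr; apply: eq_bigr => k _.
rewrite big_ord_recl unlift_none /= mulrCA; congr (_ * (_ * _)).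
by apply: eq_bigr => j _; rewrite liftK.
Qed.

Lemma ideal_exp_pred m f : ideal_exp I m.+1 f -> ideal_exp I m f.
Proof.
move=> [N [a [g [Ig ->]]]].
exists N, (fun k => a k * g k ord0), (fun k j => g k (lift ord0 j)); split=> //.
by apply: eq_bigr => k _; rewrite big_ord_recl mulrA.
Qed.

Lemma ideal_exp_le m m' f : (m' <= m)%N -> ideal_exp I m f -> ideal_exp I m' f.
Proof.
elim: m => [|m IHm]; first by rewrite leqn0 => /eqP->.
rewrite leq_eqVlt ltnS => /orP[/eqP->//|le_m'm] /ideal_exp_pred.
exact: IHm.
Qed.

End IdealPowers.

Lemma ideal_exp_map (R S : comNzRingType) (I : R -> Prop) (J : S -> Prop)
    (phi : {rmorphism R -> S}) m f :
  (forall g, I g -> J (phi g)) -> ideal_exp I m f -> ideal_exp J m (phi f).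
Proof.
move=> IJ [N [a [g [Ig ->]]]].
exists N, (fun k => phi (a k)), (fun k j => phi (g k j)); split=> [k j|]; first exact: IJ.
by rewrite rmorph_sum; apply: eq_bigr => k _; rewrite rmorphM rmorph_prod.
Qed.

(** * Homogeneous polynomials and linear forms *)

Section Homogeneous.
Variables (K : fieldType) (n : nat).
Implicit Types (f g : {mpoly K[n]}) (D : nat) (u v : 'rV[K]_n).

Lemma dhomog_ind (P : nat -> {mpoly K[n]} -> Prop) :
    P 0 1 -> (forall D, P D 0) ->
    (forall D c f g, P D f -> P D g -> P D (c *: f + g)) ->
    (forall D i f, P D f -> P D.+1 ('X_i * f)) ->
  forall D f, f \is D.-homog -> P D f.
Proof.
move=> P1 P0 PD PX.
have PXm D (mm : 'X_{1..n}) : mdeg mm = D -> P D 'X_[mm].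
  elim: D mm => [|D IHD] mm degm.
    by move/eqP: degm; rewrite mdeg_eq0 => /eqP->; rewrite mpolyX0.
  have [i mi_gt0] : exists i, mm i != 0.
    apply/existsP; rewrite -negb_forall; apply/negP => /forallP mm0.
    by move: degm; rewrite mdegE big1 // => i _; apply/eqP.
  have le1 : (U_(i) <= mm)%MM by rewrite lep1mP.
  rewrite -(submK le1) addmC mpolyXD; apply/PX/IHD.
  have := degm; rewrite -{1}(submK le1) mdegD mdeg1 addn1; exact: succn_inj.
move=> D f /dhomogP hf; rewrite (mpolyE f) big_seq.
elim/big_rec: _ => [|mm x /hf degm Px]; first exact: P0.
by apply: PD => //; apply: PXm.
Qed.

Lemma dhomog_comp k (lq : n.-tuple {mpoly K[k]}) D f :
  (forall i, tnth lq i \is 1.-homog) -> f \is D.-homog -> f \mPo lq \is D.-homog.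
Proof.
move=> hlq; move: D f; apply: dhomog_ind => [|D|D c f g hf hg|D i f hf].
- by rewrite comp_mpoly1 dhomog1.
- by rewrite comp_mpoly0 dhomog0.
- by rewrite comp_mpolyD comp_mpolyZ rpredD ?rpredZ.
- by rewrite rmorphM /= comp_mpolyXU -tnth_nth -add1n dhomogM.
Qed.

Definition linform (a : 'rV[K]_n) : {mpoly K[n]} := \sum_j a 0 j *: 'X_j.

Local Notation ev f v := (f.@[fun j => v 0 j]).

Lemma linform_is_linear : linear linform.
Proof.
move=> c a b; rewrite /linform scaler_sumr -big_split /=.
by apply: eq_bigr => j _; rewrite !mxE scalerDl scalerA.
Qed.
HB.instance Definition _ := GRing.isLinear.Build K 'rV[K]_n {mpoly K[n]} _
  linform linform_is_linear.

Lemma linform_delta i : linform (delta_mx 0 i) = 'X_i.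
Proof.
rewrite /linform (bigD1 i) //= mxE !eqxx scale1r big1 ?addr0 // => j /negPf ji.
by rewrite mxE ji andbF scale0r.
Qed.

Lemma linform_homog a : linform a \is 1.-homog.
Proof. by apply: rpred_sum => j _; rewrite rpredZ // dhomogX /= mdeg1. Qed.

Lemma linform_eval a v : ev (linform a) v = \sum_j a 0 j * v 0 j.
Proof. by rewrite raddf_sum /=; apply: eq_bigr => j _; rewrite mevalZ mevalXU. Qed.

Lemma linform_evalD a u v : ev (linform a) (u + v) = ev (linform a) u + ev (linform a) v.
Proof.
by rewrite !linform_eval -big_split; apply: eq_bigr => j _; rewrite mxE mulrDr.
Qed.

Lemma linform_evalZ a c v : ev (linform a) (c *: v) = c * ev (linform a) v.
Proof.
by rewrite !linform_eval mulr_sumr; apply: eq_bigr => j _; rewrite mxE mulrCA.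
Qed.

Lemma linform_eval_scalar (phi : {scalar 'rV[K]_n}) v :
  ev (linform (\row_j phi (delta_mx 0 j))) v = phi v.
Proof.
rewrite linform_eval [in RHS](row_sum_delta v) linear_sum.
by apply: eq_bigr => j _; rewrite mxE linearZ /= mulrC.
Qed.

Lemma linform_eq0 a : (forall v, ev (linform a) v = 0) -> linform a = 0.
Proof.
move=> a0; rewrite /linform big1 // => j _.
have := a0 (delta_mx 0 j); rewrite linform_eval (bigD1 j) //= big1 ?addr0.
  by rewrite mxE !eqxx mulr1 => ->; rewrite scale0r.
by move=> i /negPf ij; rewrite mxE ij andbF mulr0.
Qed.

Lemma separating_linform (U : {vspace 'rV[K]_n}) v : v \notin U ->
  exists a, (forall u, u \in U -> ev (linform a) u = 0) /\ ev (linform a) v = 1.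
Proof.
move=> vU; pose w := v - projv U v.
have [j wj] : exists j, w 0 j != 0.
  apply/existsP; rewrite -negb_forall; apply: contra vU => /forallP w0.
  have /eqP : w = 0 by apply/rowP => j; rewrite [RHS]mxE; apply/eqP; apply: w0.
  by rewrite subr_eq0 => /eqP->; rewrite memv_proj.
pose phi u := (u - projv U u) 0 j / w 0 j.
have phi_lin : linear_for *%R phi.
  by move=> c x y; rewrite /phi linearP !mxE; ring.
pose phiL := GRing.isLinear.Build K 'rV[K]_n K _ phi phi_lin.
pose phi' : {scalar 'rV[K]_n} := HB.pack phi phiL.
exists (\row_j phi' (delta_mx 0 j)); split=> [u uU|]; rewrite linform_eval_scalar.
  by rewrite /= /phi projv_id // subrr mxE mul0r.
by rewrite /= /phi divff.
Qed.

End Homogeneous.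
Notation ev f v := (f.@[fun j => v 0 j]).
Notation vanishing v := (ideal_exp (point_ideal <[v]>%VS)).

(** * Order of vanishing at a point, by homogeneous Taylor expansion *)

Section Vanishing.
Variables (K : closedFieldType) (n : nat).
Implicit Types (f g : {mpoly K[n]}) (D : nat) (v : 'rV[K]_n).

Lemma infinite_poly0 (q : {poly K}) : (forall c, q.[c] = 0) -> q = 0.
Proof.
move=> q0; apply/eqP; apply/negPn/negP => /negP q_neq0.
have [c] := closed_nonrootP q (introN idP q_neq0).
by rewrite rootE q0 eqxx.
Qed.

(* In coordinates where v is the first basis vector and h the first
   coordinate, this multiplies the other coordinates by a new variable, so that
   the order of vanishing at v becomes divisibility by a power of it. *)
Definition spread (h : {mpoly K[n]}) v : {mpoly K[n]} -> {poly {mpoly K[n]}} :=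
  mmap (polyC \o @mpolyC n K)
    (fun i => (v 0 i *: h)%:P + ('X_i - v 0 i *: h)%:P * 'X).
HB.instance Definition _ h v := GRing.RMorphism.on (spread h v).

Lemma spreadZ h v c f : spread h v (c *: f) = c%:MP%:P * spread h v f.
Proof. by rewrite /spread mmapZ. Qed.

Lemma spreadX h v i :
  spread h v 'X_i = (v 0 i *: h)%:P + ('X_i - v 0 i *: h)%:P * 'X.
Proof. by rewrite /spread mmapX mmap1U. Qed.

Lemma spread_linform h v a : spread h v (linform a) =
  (ev (linform a) v *: h)%:P + (linform a - ev (linform a) v *: h)%:P * 'X.
Proof.
rewrite linform_eval /linform raddf_sum /= scaler_suml.
rewrite -sumrB !raddf_sum /= mulr_suml -big_split /=.
apply: eq_bigr => j _; rewrite spreadZ spreadX mulrDr mulrA -!polyCM.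
by rewrite !mul_mpolyC scalerBr scalerA.
Qed.

Lemma spread_coef0 h v f : point_ideal <[v]> f -> (spread h v f)`_0 = 0.
Proof.
move=> vf; rewrite -horner_coef0.
(* [q] is [f] along the line spanned by [v], as a polynomial in the scalar. It is zero because K is
   infinite, and the constant coefficient of [spread h v f] is [q] evaluated at [h]. *)
pose q := mmap (@polyC K) (fun i => v 0 i *: 'X) f.
have q0 : q = 0.
  apply: infinite_poly0 => c; have <- := vf (c *: v) (memvZ c (memv_line v)).
  rewrite /q /meval /mmap horner_sum; apply: eq_bigr => mm _.
  rewrite hornerM hornerC /mmap1 horner_prod; congr (_ * _).
  by apply: eq_bigr => i _; rewrite horner_exp hornerZ hornerX mxE mulrC.
suff -> : (spread h v f).[0] = (map_poly (@mpolyC n K) q).[h].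
  by rewrite q0 rmorph0 horner0.
rewrite /q /spread /mmap rmorph_sum !horner_sum; apply: eq_bigr => mm _.
rewrite rmorphM !hornerM /= map_polyC !hornerC; congr (_ * _).
rewrite /mmap1 rmorph_prod !horner_prod; apply: eq_bigr => i _.
rewrite rmorphXn !horner_exp /= map_polyZ map_polyX !hornerE.
by rewrite ?mulr0 ?addr0 mul_mpolyC.
Qed.

Lemma spread_vanishing h v m f j :
  vanishing v m f -> (j < m)%N -> (spread h v f)`_j = 0.
Proof.
move=> [N [a [g [vg ->]]]] ltjm.
rewrite rmorph_sum coef_sum big1 // => k _; rewrite rmorphM rmorph_prod /=.
(* Each factor has constant coefficient 0; the [\poly] term is its quotient by ['X]. *)
have -> : \prod_(i < m) spread h v (g k i) =
          \prod_(i < m) (\poly_(l < size (spread h v (g k i)))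
              (spread h v (g k i))`_l.+1) * 'X^m.
  have -> : 'X^m = \prod_(i < m) 'X :> {poly {mpoly K[n]}} by rewrite prodr_const card_ord.
  rewrite -big_split /=; apply: eq_bigr => i _.
  apply/polyP => -[|l]; rewrite coefMX //=; first by rewrite spread_coef0.
  rewrite coef_poly; case: ltnP => // lel.
  by rewrite nth_default // (leq_trans lel).
by rewrite mulrA coefMXn ltjm.
Qed.

(** The possible leading terms at [v] of forms vanishing there to order k. The inductive form lets
    [bounded_form] strip off one linear factor at a time. *)
Inductive linprod v : nat -> {mpoly K[n]} -> Prop :=
| linprod_const c : linprod v 0 c%:MP
| linprod_0 k : linprod v k 0
| linprod_D k f g : linprod v k f -> linprod v k g -> linprod v k (f + g)
| linprod_M k a f : ev (linform a) v = 0 -> linprod v k f ->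
    linprod v k.+1 (linform a * f).

Lemma linprodZ v k c f : linprod v k f -> linprod v k (c *: f).
Proof.
elim=> {k f} [c'|k|k f g _ If _ Ig|k a f av _ If].
- by rewrite -mul_mpolyC -mpolyCM; constructor.
- by rewrite scaler0; constructor.
- by rewrite scalerDr; constructor.
- by rewrite scalerAr; constructor.
Qed.

Lemma linprod_homog v k f : linprod v k f -> f \is k.-homog.
Proof.
elim=> {k f} [c|k|k f g _ If _ Ig|k a f av _ If].
- by rewrite -[c%:MP]mulr1 mul_mpolyC rpredZ ?dhomog1.
- exact: dhomog0.
- exact: rpredD.
- by rewrite -add1n dhomogM ?linform_homog.
Qed.

Lemma point_ideal_linform v a : ev (linform a) v = 0 -> point_ideal <[v]> (linform a).
Proof. by move=> av u /vlineP[c ->]; rewrite linform_evalZ av mulr0. Qed.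

Lemma linprod_vanishing v k f : linprod v k f -> vanishing v k f.
Proof.
elim=> {k f} [c|k|k f g _ If _ Ig|k a f av _ If].
- exact: ideal_exp_exp0.
- exact: ideal_exp_0.
- exact: ideal_exp_D.
- by apply: ideal_exp_S => //; apply: point_ideal_linform.
Qed.

Lemma linprod_spread h v k f : linprod v k f -> spread h v f = f%:P * 'X^k.
Proof.
elim=> {k f} [c|k|k f g _ If _ Ig|k a f av _ If].
- by rewrite /spread mmapC mulr1.
- by rewrite rmorph0 mul0r.
- by rewrite rmorphD /= If Ig polyCD mulrDl.
- rewrite rmorphM /= If spread_linform av scale0r subr0 add0r polyCM exprS.
  by rewrite !mulrA; congr (_ * _); rewrite -!mulrA; congr (_ * _); rewrite mulrC.
Qed.

Section LocalParameter.
Variables (v a : 'rV[K]_n).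
Local Notation h := (linform a).
Hypothesis hv : ev h v = 1.

(** Taylor expansion at [v], made homogeneous by [h]: each variable ['X_i] is [v 0 i *: h] plus a
    linear form vanishing at [v]. *)
Lemma dhomog_expansion D f : f \is D.-homog ->
  exists phi : nat -> {mpoly K[n]}, (forall j, linprod v j (phi j)) /\
    f = \sum_(j < D.+1) h ^+ (D - j) * phi j.
Proof.
move: D f; apply: dhomog_ind => [|D|D c f g [phi [Lphi ->]] [psi [Lpsi ->]]|D i f].
- exists (fun j => if j is 0 then 1%:MP else 0); split=> [[|j]|]; try by constructor.
  by rewrite big_ord1 mul1r.
- exists (fun=> 0); split=> [j|]; first by constructor.
  by rewrite big1 // => j _; rewrite mulr0.
- exists (fun j => c *: phi j + psi j); split=> [j|].
    by apply: linprod_D => //; apply: linprodZ.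
  rewrite scaler_sumr -big_split; apply: eq_bigr => j _ /=.
  by rewrite mulrDr scalerAr.
- move=> [phi [Lphi ->]].
  pose b := delta_mx 0 i - v 0 i *: a : 'rV[K]_n.
  have bE : linform b = 'X_i - v 0 i *: h by rewrite linearB linearZ /= linform_delta.
  have bv : ev (linform b) v = 0.
    by rewrite bE mevalB mevalZ hv mulr1 mevalXU subrr.
  exists (fun j => (if (j <= D)%N then v 0 i *: phi j else 0) +
             if j is j'.+1 then linform b * phi j' else 0); split=> [j|].
    apply: linprod_D.
      by case: ifP => _; [apply: linprodZ | apply: linprod_0].
    by case: j => [|j]; [apply: linprod_0 | apply: linprod_M].
  under [RHS]eq_bigr do rewrite mulrDr.
  rewrite big_split /= [X in _ = X + _]big_ord_recr /= ltnn mulr0 addr0.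
  rewrite [X in _ = _ + X]big_ord_recl /= mulr0 add0r -big_split mulr_sumr.
  apply: eq_bigr => j _; rewrite /= leq_ord subSS.
  have -> : 'X_i = linform b + v 0 i *: h by rewrite bE subrK.
  rewrite mulrDl addrC; congr (_ + _); first by rewrite add0n mulrCA.
  by rewrite subSn ?leq_ord // exprS -scalerAl -scalerAr mulrA.
Qed.

Lemma spread_expansion D (phi : nat -> {mpoly K[n]}) k :
    (forall j, linprod v j (phi j)) -> (k <= D)%N ->
  (spread h v (\sum_(j < D.+1) h ^+ (D - j) * phi j))`_k = h ^+ (D - k) * phi k.
Proof.
move=> Lphi lekD; have ltk : (k < D.+1)%N by [].
rewrite rmorph_sum coef_sum (bigD1 (Ordinal ltk)) //= big1 ?addr0 => [|j jk].
  rewrite rmorphM rmorphXn /= spread_linform hv scale1r subrr mul0r addr0.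
  rewrite (linprod_spread _ (Lphi k)) -polyC_exp mulrA -polyCM coefCM.
  by rewrite coefXn eqxx mulr1.
rewrite rmorphM rmorphXn /= spread_linform hv scale1r subrr mul0r addr0.
rewrite (linprod_spread _ (Lphi j)) -polyC_exp mulrA -polyCM coefCM.
by rewrite coefXn eq_sym (negPf (jk : (j : nat) != k)) mulr0.
Qed.

(** Only the low coefficients of [spread] are assumed to vanish. This condition passes at once from
    [h * f] to [f], since [spread] sends [h] to a nonzero constant polynomial; [vanishing_cancel1]
    relies on it. *)
Lemma vanishing_expansion D m f : f \is D.-homog ->
    (forall j, (j < m)%N -> (spread h v f)`_j = 0) ->
  exists phi : nat -> {mpoly K[n]}, (forall j, linprod v j (phi j)) /\
    f = \sum_(j < D.+1 | (m <= j)%N) h ^+ (D - j) * phi j.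
Proof.
move=> /dhomog_expansion[phi [Lphi ->]] f0; exists phi; split=> //.
rewrite [RHS]big_mkcond; apply: eq_bigr => j _; case: leqP => // ltjm.
by have := f0 j ltjm; rewrite spread_expansion // leq_ord.
Qed.

Lemma vanishing_sum D m (phi : nat -> {mpoly K[n]}) : (forall j, linprod v j (phi j)) ->
  vanishing v m (\sum_(j < D.+1 | (m <= j)%N) h ^+ (D - j) * phi j).
Proof.
move=> Lphi; apply: ideal_exp_sum => j lemj.
by apply: ideal_exp_Ml; apply: ideal_exp_le lemj _; apply: linprod_vanishing.
Qed.

Lemma vanishing_lead D k f : f \is D.-homog -> (k <= D)%N -> vanishing v k f ->
  exists2 phi, linprod v k phi & vanishing v k.+1 (f - h ^+ (D - k) * phi).
Proof.
move=> hf lekD vf.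
have [j ltjk|phi [Lphi ->]] := vanishing_expansion (m := k) hf.
  exact: spread_vanishing vf ltjk.
exists (phi k) => //; have ltk : (k < D.+1)%N by [].
rewrite (bigD1 (Ordinal ltk)) //= addrAC subrr add0r.
rewrite (eq_bigl (fun j : 'I_D.+1 => (k.+1 <= j)%N)); first exact: vanishing_sum.
by move=> j; rewrite ltn_neqAle andbC -val_eqE eq_sym.
Qed.

(** Only the Taylor terms of order below m matter. Their order is at most D, so each of them
    contains the factor [h ^+ N]. *)
Lemma vanishing_divide1 D N m f : f \is (D + N).-homog -> (m <= D.+1)%N ->
  exists2 g, g \is D.-homog & vanishing v m (f - h ^+ N * g).
Proof.
move=> /dhomog_expansion[phi [Lphi ->]] lemD.
exists (\sum_(j < m) h ^+ (D - j) * phi j).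
  rewrite rpred_sum // => j _; have lejD : (j <= D)%N by rewrite -ltnS (leq_trans _ lemD).
  rewrite -{2}(subnK lejD) dhomogM //; last exact: linprod_homog.
  by have := dhomogMn (D - j) (linform_homog a); rewrite mul1n.
have lemDN : (m <= (D + N).+1)%N by rewrite (leq_trans lemD) // ltnS leq_addr.
rewrite (big_ord_widen _ (fun j => h ^+ (D - j) * phi j) lemDN) mulr_sumr.
rewrite (bigID (fun j : 'I__ => (j < m)%N)) /= addrAC -sumrB.
rewrite [X in X + _]big1 ?add0r => [|j ltjm].
  rewrite (eq_bigl (fun j : 'I__ => (m <= j)%N)); first exact: vanishing_sum.
  by move=> j; rewrite -leqNgt.
have lejD : (j <= D)%N by rewrite -ltnS (leq_trans ltjm).
by rewrite mulrA -exprD addnBA // [(N + D)%N]addnC subrr.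
Qed.

Lemma vanishing_cancel1 D m f :
  f \is D.-homog -> vanishing v m (h * f) -> vanishing v m f.
Proof.
move=> hf vhf; have [j ltjm|phi [Lphi ->]] := vanishing_expansion (m := m) hf.
  have /eqP := spread_vanishing h vhf ltjm; rewrite rmorphM /= spread_linform hv.
  rewrite scale1r subrr mul0r addr0 coefCM mulf_eq0 => /orP[/eqP h0|/eqP//].
  by move: hv; rewrite h0 meval0 => /esym/eqP; rewrite oner_eq0.
exact: vanishing_sum.
Qed.

End LocalParameter.

Lemma linform_normalize v a : ev (linform a) v != 0 ->
  exists b c, [/\ ev (linform b) v = 1, linform a = c *: linform b & c != 0].
Proof.
move=> av; exists ((ev (linform a) v)^-1 *: a), (ev (linform a) v).
by rewrite linearZ /= mevalZ mulVf // scalerA divff // scale1r.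
Qed.

Lemma vanishing_divide v a D N m f : ev (linform a) v != 0 ->
    f \is (D + N).-homog -> (m <= D.+1)%N ->
  exists2 g, g \is D.-homog & vanishing v m (f - linform a ^+ N * g).
Proof.
move=> /linform_normalize[b [c [bv -> c0]]] hf lemD.
have [g hg vg] := vanishing_divide1 bv hf lemD.
exists ((c ^- N) *: g); first exact: rpredZ.
by rewrite exprZn -scalerAl -scalerAr scalerA divff ?expf_neq0 // scale1r.
Qed.

Lemma vanishing_cancel v a D N m f : ev (linform a) v != 0 -> f \is D.-homog ->
  vanishing v m (linform a ^+ N * f) -> vanishing v m f.
Proof.
move=> /linform_normalize[b [c [bv -> c0]]].
elim: N D f => [|N IHN] D f hf; first by rewrite mul1r.
have hcf : c *: linform b * f \is (1 + D).-homog.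
  by rewrite dhomogM // rpredZ // linform_homog.
rewrite exprSr -mulrA => /(IHN _ _ hcf); rewrite -scalerAl.
move=> /(ideal_exp_Ml (c^-1)%:MP); rewrite mul_mpolyC scalerA mulVf // scale1r.
exact: vanishing_cancel1 hf.
Qed.

End Vanishing.

Local Close Scope ring_scope.

(** * Weighted vectors and hyperplanes avoiding a point *)

Section Spans.
Variables (K : fieldType) (vT : vectType K).
Implicit Types (u w x y z : vT) (X : seq vT) (U W : {vspace vT}).

Lemma span_exchange X x y :
  x \notin <<X>>%VS -> y \notin <<x :: X>>%VS -> x \notin <<y :: X>>%VS.
Proof.
move=> xX; apply: contra; rewrite !span_cons => /memv_addP[y' /vlineP[a ->] [w wX xE]].
have [a0|a0] := eqVneq a 0%R.
  by move: xX; rewrite xE a0 scale0r add0r wX.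
have -> : y = (a^-1 *: x + a^-1 *: (- w))%R.
  by rewrite -scalerDr xE addrK scalerA mulVf // scale1r.
by rewrite memv_add // ?memvZ ?memv_line ?memvN.
Qed.

Lemma span1_notin x y : x != 0%R -> y \notin <<[:: x]>>%VS -> x \notin <<[:: y]>>%VS.
Proof. by move=> x0; apply: span_exchange; rewrite span_nil memv0. Qed.

Lemma span_dim_eq W X : (forall u, u \in X -> u \in W) -> \dim W <= \dim <<X>> -> W = <<X>>%VS.
Proof.
by move=> XW dW; apply/esym/eqP; rewrite eqEdim dW andbT; apply/span_subvP.
Qed.

Lemma dim_span_cons x X : x \notin <<X>>%VS -> \dim <<x :: X>> = (\dim <<X>>).+1.
Proof.
move=> xX; have x0 : x != 0%R by apply: contra xX => /eqP->; rewrite mem0v.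
rewrite span_cons dimv_disjoint_sum ?dim_vline ?x0 //.
apply/eqP; rewrite -subv0; apply/subvP => u; rewrite memv_cap => /andP[/vlineP[c ->]].
have [->|c0] := eqVneq c 0%R; first by rewrite scale0r !mem0v.
by move=> /(memvZ (c^-1)%R); rewrite scalerA mulVf // scale1r (negPf xX).
Qed.

Lemma dim_cap_lt U W : ~~ (U <= W)%VS -> \dim (U :&: W) < \dim U.
Proof.
move=> nUW; rewrite ltnNge; apply: contra nUW => dU.
have /eqP <- : (U :&: W == U)%VS by rewrite eqEdim capvSl dU.
exact: capvSr.
Qed.

End Spans.

Ltac in_span := by rewrite memv_span // !inE eqxx ?orbT.
Ltac span_sub := apply/span_subvP => ?; rewrite !inE;
  do ?[case/predU1P=> [->|]]; try (move=> /eqP->); assumption.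

Ltac clear_memberships := repeat match goal with
  | H : is_true ?b |- _ => lazymatch b with leq _ _ => fail | _ => clear H end
  | H : forall _, _ |- _ => clear H
  end.
Ltac arith := intros; clear_memberships; lia.

Section Weights.
Variables (K : fieldType) (vT : vectType K) (s : nat) (v : 'I_s -> vT).
Implicit Types (c : 'I_s -> nat) (A B U W G : {vspace vT}).

Definition wt c W := \sum_(i < s | v i \in W) c i.
Definition outside c W := \sum_(i < s | v i \notin W) c i.
(** Multiplicities still required after one hyperplane through the points of U has been used. The
    subtraction truncates, so a point of multiplicity 0 on U stays at 0. *)
Definition cut c U i := c i - (v i \in U).

Lemma wt_outside c W : wt c fullv = wt c W + outside c W.
Proof.
rewrite /wt /outside [LHS](bigID (fun i => v i \in W)) /=.
by congr (_ + _); apply: eq_bigl => i; rewrite memvf.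
Qed.

Lemma wt_sub c A B : (A <= B)%VS -> wt c A <= wt c B.
Proof.
move=> /subvP sAB; rewrite /wt [leqRHS](bigID (fun i => v i \in A)) /=.
rewrite (eq_bigl (fun i => (v i \in B) && (v i \in A))) ?leq_addr // => i.
by rewrite andbC andb_idr // => /sAB.
Qed.

Lemma wt_ge c W i : v i \in W -> c i <= wt c W.
Proof. by move=> iW; rewrite /wt (bigD1 i) //= leq_addr. Qed.

Lemma wt_exists c A B : wt c B < wt c A ->
  exists i, [/\ 0 < c i, v i \in A & v i \notin B].
Proof.
move=> ltBA; apply: NNPP => nex; move: ltBA; rewrite ltnNge => /negP; apply.
rewrite /wt (bigID (fun i => v i \in B)) /= [X in _ + X]big1 => [|i /andP[iA iB]].
  rewrite addn0 [leqRHS](bigID (fun i => v i \in A)) /=.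
  by under eq_bigl do rewrite andbC; rewrite leq_addr.
by apply/eqP; rewrite -leqn0 leqNgt; apply/negP => ci; apply: nex; exists i.
Qed.

Lemma outside_exists c G W : wt c W < wt c (W :&: G) + outside c G ->
  exists i, [/\ 0 < c i, v i \notin G & v i \notin W].
Proof.
move=> lt; apply: NNPP => nex; move: lt; rewrite ltnNge => /negP; apply.
rewrite /wt [leqRHS](bigID (fun i => v i \in G)) /= leq_add //.
  by under eq_bigl do rewrite memv_cap.
rewrite /outside (bigID (fun i => v i \in W)) /= [X in _ + X]big1 => [|i /andP[iG iW]].
  by rewrite addn0; under eq_bigl do rewrite andbC.
by apply/eqP; rewrite -leqn0 leqNgt; apply/negP => ci; apply: nex; exists i.
Qed.

Lemma wt_cap c A B G : (A <= G)%VS -> (B <= G)%VS ->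
  wt c A + wt c B + \sum_(i < s | (v i \in G) && ~~ ((v i \in A) || (v i \in B))) c i
  = wt c G + wt c (A :&: B).
Proof.
move=> /subvP AG /subvP BG; rewrite /wt ![\sum_(i < s | _) _]big_mkcond /= -!big_split /=.
apply: eq_bigr => i _; rewrite memv_cap.
have := AG (v i); have := BG (v i).
by case: (v i \in A) (v i \in B) (v i \in G) => [] [] [] //= H1 H2; try (by have := H1 isT);
  try (by have := H2 isT); rewrite ?addn0 ?add0n.
Qed.

Lemma wt_cap_le c A B G : (A <= G)%VS -> (B <= G)%VS ->
  wt c A + wt c B <= wt c G + wt c (A :&: B).
Proof. by move=> AG BG; rewrite -(wt_cap c AG BG) leq_addr. Qed.

Lemma wt_cap_lt c A B G i : (A <= G)%VS -> (B <= G)%VS ->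
    0 < c i -> v i \in G -> v i \notin A -> v i \notin B ->
  wt c A + wt c B < wt c G + wt c (A :&: B).
Proof.
move=> AG BG ci iG iA iB; rewrite -(wt_cap c AG BG) -addn1 leq_add2l.
by rewrite (bigD1 i) ?iG ?negb_or ?iA ?iB //= (leq_trans ci) ?leq_addr.
Qed.

Lemma wt_le_caps c A B W : (forall i, 0 < c i -> (v i \in A) || (v i \in B)) ->
  wt c W <= wt c (W :&: A) + wt c (W :&: B).
Proof.
move=> cAB; rewrite /wt ![\sum_(i < s | _) _]big_mkcond /= -!big_split /=.
apply: leq_sum => i _; rewrite !memv_cap; case: posnP (cAB i) => [->|ci /(_ isT)].
  by rewrite !if_same.
by case: (v i \in W) => //= /orP[] ->; rewrite ?leq_addr ?leq_addl.
Qed.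

Lemma cut_le c U i : cut c U i <= c i. Proof. exact: leq_subr. Qed.

Lemma wt_le c c' W : (forall i, c i <= c' i) -> wt c W <= wt c' W.
Proof. by move=> cc'; apply: leq_sum. Qed.

Lemma outside_le c c' W : (forall i, c i <= c' i) -> outside c W <= outside c' W.
Proof. by move=> cc'; apply: leq_sum. Qed.

Lemma cut_loss (D : pred 'I_s) c U (X : seq 'I_s) : uniq X ->
    (forall i, i \in X -> [/\ 0 < c i, D i & v i \in U]) ->
  \sum_(i < s | D i) cut c U i + size X <= \sum_(i < s | D i) c i.
Proof.
move=> uX DX; have -> : size X = \sum_(i < s | D i) (i \in X).
  rewrite -(card_uniqP uX) -sum1_card big_mkcond [RHS]big_mkcond /=.
  by apply: eq_bigr => i _; case: ifP => [/DX[_ -> _]//|_]; rewrite if_same.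
rewrite -big_split leq_sum // => i Di; rewrite /cut /=.
by case: (boolP (i \in X)) => [/DX[ci _ ->]|_]; [rewrite subnK | rewrite addn0 leq_subr].
Qed.

Lemma wt_cut c U W (X : seq 'I_s) : uniq X ->
    (forall i, i \in X -> [/\ 0 < c i, v i \in W & v i \in U]) ->
  wt (cut c U) W + size X <= wt c W.
Proof. exact: cut_loss. Qed.

Lemma wt_cut_le c U W : wt (cut c U) W <= wt c W.
Proof. exact/wt_le/cut_le. Qed.

(** * Subspaces through P and the partition into independent sets *)

Section Pencil.
Variable (P : vT).
Hypothesis P0 : P != 0%R.

Lemma wt_point0 c i : wt c <<[:: P]>> = 0 -> 0 < c i -> v i \notin <<[:: P]>>%VS.
Proof.
by move=> cP ci; apply/negP => /(wt_ge c); rewrite cP leqNgt ci.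
Qed.

Lemma pencil_eq c U i : wt c <<[:: P]>> = 0 -> P \in U -> \dim U <= 2 ->
  0 < c i -> v i \in U -> U = <<[:: v i; P]>>%VS.
Proof.
move=> cP PU dU ci iU; apply: span_dim_eq => [u|].
  by rewrite !inE => /orP[]/eqP->.
by rewrite dim_span_cons ?(wt_point0 cP) // span_seq1 dim_vline P0.
Qed.

(** Distinct lines through P meet only in P, which carries no weight. *)
Lemma wt_pencil_cap c U W i : wt c <<[:: P]>> = 0 -> P \in U -> P \in W ->
    \dim U <= 2 -> \dim W <= 2 -> v i \in U -> v i \notin W ->
  wt c (U :&: W) = 0.
Proof.
move=> cP PU PW dU dW iU iW; apply/eqP; rewrite -leqn0 leqNgt; apply/negP => gt0.
have [|j [cj]] := @wt_exists c (U :&: W) <<[:: P]>>; first by rewrite cP.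
rewrite memv_cap => /andP[jU jW] _; move: iW.
by rewrite (pencil_eq cP PW dW cj jW) -(pencil_eq cP PU dU cj jU) iU.
Qed.

(* Some e hyperplanes avoiding P together pass through each v i at least c i
   times; a subspace U avoiding P extends to such a hyperplane. *)
Fixpoint coverable e c : Prop :=
  if e is e'.+1 then exists2 U : {vspace vT}, P \notin U & coverable e' (cut c U)
  else forall i, c i = 0.

(** For d = k + e and P of multiplicity k + 1, the bounds on lines, planes and the whole space are d
    + 1, 2d + 1 and 3d + 1, each reduced by k + 1. Here k counts the planes through P still to be
    used; k = 0 is the hypothesis of the partition theorem. *)
Definition bounded e k c :=
  [/\ wt c <<[:: P]>> = 0,
      forall U : {vspace vT}, P \in U -> \dim U <= 2 -> wt c U <= e,
      forall W : {vspace vT}, P \in W -> \dim W <= 3 -> wt c W <= 2 * e + k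
    & wt c fullv <= 3 * e + 2 * k].

Lemma wt_eq0 c : wt c fullv = 0 -> forall i, c i = 0.
Proof. by move=> c0 i; apply/eqP; rewrite -leqn0 -c0 wt_ge ?memvf. Qed.

Lemma coverable0 e c : (forall i, c i = 0) -> coverable e c.
Proof.
elim: e c => // e IHe c c0; exists 0%VS; first by rewrite memv0.
by apply: IHe => i; rewrite /cut c0.
Qed.

Lemma wt_point_cut c U : wt c <<[:: P]>> = 0 -> wt (cut c U) <<[:: P]>> = 0.
Proof. by move=> cP; apply/eqP; rewrite -leqn0 -cP wt_cut_le. Qed.

(** Partition in rank 2 for the lines through P in G, with room in each class for one point outside
    G. Each round removes, as far as available, two points of G not on a common line through P, and
    one point outside G. *)
Lemma coverable_flat e c G : wt c <<[:: P]>> = 0 -> P \in G ->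
    (forall U : {vspace vT}, P \in U -> (U <= G)%VS -> \dim U <= 2 -> wt c U <= e) ->
    wt c G <= 2 * e -> outside c G <= e ->
  coverable e c.
Proof.
elim: e c => [|e IHe] c cP PG cU cG cO.
  apply: wt_eq0; rewrite (wt_outside c G).
  by move: cG cO; rewrite muln0 !leqn0 => /eqP-> /eqP->.
(* [X] is the part of the removed set inside G. The claim is made for all [V] containing it because
   a point outside G may be adjoined to the span afterwards. *)
have [X [PX XG XP]] : exists X, [/\ P \notin <<X>>%VS, (<<X>> <= G)%VS &
    forall V, (<<X>> <= V)%VS -> wt (cut c V) G <= 2 * e /\
      forall U : {vspace vT}, P \in U -> (U <= G)%VS -> \dim U <= 2 -> wt (cut c V) U <= e].
  have [cG0|cG_gt0] := posnP (wt c G).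
    exists [::]; split=> [||V _]; rewrite ?span_nil ?memv0 ?sub0v //.
    have cV0 U : (U <= G)%VS -> wt (cut c V) U = 0.
      move=> UG; apply/eqP; rewrite -leqn0 -cG0.
      exact: leq_trans (wt_cut_le _ _ _) (wt_sub _ UG).
    by split=> [|U _ UG _]; rewrite cV0 ?subvv.
  have [|x0 [cx0 x0G _]] := @wt_exists c G <<[:: P]>>; first by rewrite cP.
  have Dx0 : (0 < c x0) && (v x0 \in G) by rewrite cx0.
  pose F i := wt c <<[:: v i; P]>>.
  have [x [cx xG xmax]] : exists x, [/\ 0 < c x, v x \in G & forall i, 0 < c i ->
      v i \in G -> wt c <<[:: v i; P]>> <= wt c <<[:: v x; P]>>].
    case: (@arg_maxnP _ x0 (fun i => (0 < c i) && (v i \in G)) F Dx0) => x /andP[cx xG] xm.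
    by exists x; split=> // i ci iG; apply: xm; rewrite ci.
  clear F x0 cx0 x0G Dx0.
  have xP := wt_point0 cP cx; have Px := span1_notin P0 xP.
  have dUx : \dim <<[:: v x; P]>> <= 2 by rewrite dim_span.
  have UxG : (<<[:: v x; P]>> <= G)%VS by span_sub.
  have PUx : P \in <<[:: v x; P]>>%VS by in_span.
  have [leG|ltG] := leqP (wt c G) (wt c <<[:: v x; P]>>).
    have cUx := cU _ PUx UxG dUx.
    exists [:: v x]; split=> [//||V XV].
      by span_sub.
    have xV : v x \in V by apply: (subvP XV); in_span.
    have lossG : wt (cut c V) G + 1 <= wt c G.
      by apply: (@wt_cut _ _ _ [:: x]) => // i; rewrite inE => /eqP->.
    have cVG : wt (cut c V) G <= e.
      by arith.
    split=> [|U _ UG _]; first by arith.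
    exact: leq_trans (wt_sub _ UG) cVG.
  have [y [cy yG yUx]] := wt_exists ltG.
  have yx : y != x by apply: contra yUx => /eqP->; in_span.
  exists [:: v y; v x]; split=> [||V XV].
  - apply: span_exchange => //.
    by rewrite (@eq_span _ _ _ [:: v x; P]) // => u; rewrite !inE orbC.
  - by span_sub.
  have xV : v x \in V by apply: (subvP XV); in_span.
  have yV : v y \in V by apply: (subvP XV); in_span.
  split=> [|U PU UG dU].
    have : wt (cut c V) G + 2 <= wt c G; last by arith.
    apply: (@wt_cut _ _ _ [:: y; x]) => [|i]; first by rewrite /= inE yx.
    by rewrite !inE => /orP[]/eqP->.
  have loss i : 0 < c i -> v i \in U -> v i \in V -> wt (cut c V) U <= e.
    move=> ci iU iV; have : wt (cut c V) U + 1 <= wt c U.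
      by apply: (@wt_cut _ _ _ [:: i]) => // j; rewrite inE => /eqP->.
    by have := cU U PU UG dU; arith.
  have [/loss->//|xU] := boolP (v x \in U).
  have [/loss->//|yU] := boolP (v y \in U).
  (* Suppose [U] has weight e + 1 and misses both points. By maximality the line through P and [v x]
     is at least as heavy, and [v y] lies on neither, so G would weigh more than 2(e + 1). *)
  apply: leq_trans (wt_cut_le _ _ _) _; rewrite leqNgt; apply/negP => gtU.
  have [|i [ci iU _]] := @wt_exists c U <<[:: P]>>; first by rewrite cP; arith.
  have := xmax i ci (subvP UG _ iU); rewrite -(pencil_eq cP PU dU ci iU) => leU.
  have := wt_cap_lt UG UxG cy yG yU yUx.
  rewrite capvC (@wt_pencil_cap c _ U x) //; last by in_span.
  by rewrite addn0; arith.
have [O0|O_gt0] := posnP (outside c G).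
  have [cVG cVU] := XP <<X>>%VS (subvv _).
  exists <<X>>%VS => //; apply: (IHe _ (wt_point_cut _ cP) PG) => //.
  by apply: leq_trans (outside_le _ (cut_le _ _)) _; rewrite O0.
have [|z [cz zG _]] := @outside_exists c G <<[:: P]>>.
  by rewrite cP ltn_addl.
have zPX : v z \notin <<P :: X>>%VS.
  by apply: contra zG; apply: subvP; rewrite span_cons subv_add -memvE PG XG.
exists <<v z :: X>>%VS; first exact: span_exchange.
have [cVG cVU] := XP _ (sub_span (fun u => @mem_behead _ (v z :: X) u)).
apply: (IHe _ (wt_point_cut _ cP) PG) => //.
have : outside (cut c <<v z :: X>>) G + 1 <= outside c G; last by arith.
apply: (@cut_loss _ _ _ [:: z]) => // i; rewrite inE => /eqP->; split=> //.
by in_span.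
Qed.

(** If some plane G is within one of its bound, the removed sets must respect G, which leads to
    [coverable_flat]. Otherwise the removed set can be a maximal independent set containing a point
    of a heaviest line through P. *)
Lemma coverable_bounded e c : bounded e 0 c -> coverable e c.
Proof.
elim: e c => [|e IHe] c [cP cU cW cT]; first by apply: wt_eq0; arith.
have [[G [PG dG cG]]|noG] :=
  classic (exists G, [/\ P \in G, \dim G <= 3 & 2 * e.+1 <= (wt c G).+1]).
  have UG U : P \in U -> (U <= G)%VS -> \dim U <= 2 -> wt c U <= e.+1.
    by move=> PU _; apply: cU.
  have leG := cW G PG dG; have totE := wt_outside c G.
  have [Oe|Oe] := leqP (outside c G) e.+1; first by apply: coverable_flat UG _ Oe => //; arith.
  (* Now G weighs 2e + 1 and the outside e + 2, one too many for [coverable_flat] at e + 1. Removing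
     one point of G and two points outside leaves 2e and e, which fits [coverable_flat] at e. *)
  have flat w y z : 0 < c w -> 0 < c y -> 0 < c z -> v w \in G ->
      v y \notin G -> v z \notin G -> v z \notin <<[:: P; v y]>>%VS ->
      P \notin <<[:: v w; v z; v y]>>%VS ->
      (forall U : {vspace vT}, P \in U -> (U <= G)%VS -> \dim U <= 2 ->
        v w \notin U -> wt c U <= e) ->
    coverable e.+1 c.
    move=> cw cy cz wG yG zG zy nP wU; exists <<[:: v w; v z; v y]>>%VS => //.
    have zNy : z != y by apply: contra zy => /eqP->; in_span.
    apply: (coverable_flat (wt_point_cut _ cP) PG) => [U PU sUG dU||].
    - have [wUin|/(wU U PU sUG dU)] := boolP (v w \in U); last exact/leq_trans/wt_cut_le.
      have : wt (cut c <<[:: v w; v z; v y]>>) U + 1 <= wt c U.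
        by apply: (@wt_cut _ _ _ [:: w]) => // i; rewrite inE => /eqP->; split=> //; in_span.
      by have := cU U PU dU; arith.
    - have : wt (cut c <<[:: v w; v z; v y]>>) G + 1 <= wt c G; last by arith.
      by apply: (@wt_cut _ _ _ [:: w]) => // i; rewrite inE => /eqP->; split=> //; in_span.
    - have : outside (cut c <<[:: v w; v z; v y]>>) G + 2 <= outside c G; last by arith.
      apply: (@cut_loss _ _ _ [:: z; y]) => [|i]; first by rewrite /= inE zNy.
      by rewrite !inE => /orP[]/eqP->; split=> //; in_span.
  have [|y [cy yG _]] := @outside_exists c G <<[:: P]>>; first by rewrite cP; arith.
  (* As G weighs 2e + 1, at most one line through P in G has weight e + 1; if there is one, [w] is
     taken on it. *)
  have [[U [PU sUG dU ltU]]|noU] :=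
    classic (exists U : {vspace vT}, [/\ P \in U, (U <= G)%VS, \dim U <= 2 & e < wt c U]).
    have [|w [cw wU _]] := @wt_exists c U <<[:: P]>>; first by rewrite cP; arith.
    have wG := subvP sUG _ wU; have wP := wt_point0 cP cw.
    have yR : v y \notin <<[:: P; v w]>>%VS by apply: contra yG; apply: subvP; span_sub.
    have [|z [cz zG zR]] := @outside_exists c G <<[:: v y; P; v w]>>.
      have PR : P \in <<[:: v y; P; v w]>>%VS by in_span.
      have := cW _ PR (dim_span _).
      have : wt c U <= wt c (<<[:: v y; P; v w]>> :&: G); last by arith.
      apply: wt_sub; rewrite subv_cap sUG andbT (pencil_eq cP PU dU cw wU).
      by apply: sub_span => u; rewrite !inE => /orP[]->; rewrite ?orbT.
    apply: (flat w y z) => // [||U' PU' sU'G dU' wU'].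
    + apply: contra zR; apply: subvP; apply: sub_span => u.
      by rewrite !inE => /orP[]->; rewrite ?orbT.
    + rewrite (@eq_span _ _ _ [:: v z; v y; v w]); last by move=> u; rewrite !inE orbC -orbA.
      apply: span_exchange; last first.
        by rewrite (@eq_span _ _ _ [:: v y; P; v w]) // => u; rewrite !inE orbCA.
      by apply: span_exchange => //; apply: span1_notin.
    + rewrite leqNgt; apply/negP => ltU'.
      by have := wt_cap_le c sUG sU'G; rewrite (@wt_pencil_cap c _ _ w) //; arith.
  have ltU U : P \in U -> (U <= G)%VS -> \dim U <= 2 -> wt c U <= e.
    by move=> PU sUG dU; rewrite leqNgt; apply/negP => ltU; apply: noU; exists U.
  have yP := wt_point0 cP cy.
  have [|z [cz zG zR]] := @outside_exists c G <<[:: P; v y]>>.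
    have PR : P \in <<[:: P; v y]>>%VS by in_span.
    by have := cU _ PR (dim_span _); arith.
  pose R := <<[:: P; v z; v y]>>%VS.
  have PR : P \in R by in_span.
  have [|w [cw wG wR]] := @wt_exists c G (R :&: G).
    apply: (@leq_ltn_trans e); last by arith.
    apply: ltU; rewrite ?memv_cap ?PR ?capvSr //.
    have nRG : ~~ (R <= G)%VS by apply: contra yG => /subvP; apply; in_span.
    by rewrite -ltnS; apply: leq_trans (dim_cap_lt nRG) (dim_span _).
  apply: (flat w y z) => //; last by move=> *; apply: ltU.
  apply: span_exchange; last by apply: contra wR; rewrite memv_cap wG andbT.
  by apply: span_exchange => //; apply: span1_notin.
(* So the plane bound for e already holds; the removed set only has to meet every line of weight e +
   1 and to bring the total down to 3e. *)
have ltW W : P \in W -> \dim W <= 3 -> wt c W <= 2 * e.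
  move=> PW dW; rewrite leqNgt; apply/negP => ltW; apply: noG; exists W; split=> //; arith.
have [c0|c_gt0] := posnP (wt c fullv); first exact/coverable0/wt_eq0.
have [|x0 [cx0 _ _]] := @wt_exists c fullv <<[:: P]>>; first by rewrite cP.
pose F i := wt c <<[:: v i; P]>>.
have [x cx xmax] : exists2 x, 0 < c x & forall i, 0 < c i ->
    wt c <<[:: v i; P]>> <= wt c <<[:: v x; P]>>.
  by case: (@arg_maxnP _ x0 (fun i => 0 < c i) F cx0) => x cx xm; exists x.
clear F x0 cx0.
have xP := wt_point0 cP cx; have Px := span1_notin P0 xP.
have finish (V : {vspace vT}) :
    v x \in V -> P \notin V -> wt (cut c V) fullv <= 3 * e -> coverable e.+1 c.
  move=> xV PV tV; exists V => //; apply: IHe; split=> [|U PU dU|W PW dW|]; last by arith.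
  - exact: wt_point_cut.
  - have loss i : 0 < c i -> v i \in U -> v i \in V -> wt (cut c V) U <= e.
      move=> ci iU iV; have : wt (cut c V) U + 1 <= wt c U.
        by apply: (@wt_cut _ _ _ [:: i]) => // j; rewrite inE => /eqP->.
      by have := cU U PU dU; arith.
    have [/loss->//|xU] := boolP (v x \in U).
    apply: leq_trans (wt_cut_le _ _ _) _; rewrite leqNgt; apply/negP => gtU.
    have [|i [ci iU _]] := @wt_exists c U <<[:: P]>>; first by rewrite cP; arith.
    have := xmax i ci; rewrite -(pencil_eq cP PU dU ci iU) => leU.
    have UE := pencil_eq cP PU dU ci iU.
    have PW : P \in <<[:: v x; v i; P]>>%VS by in_span.
    have := ltW _ PW (dim_span _).
    have sU : (U <= <<[:: v x; v i; P]>>)%VS.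
      by rewrite UE; apply: sub_span => u; rewrite !inE => ->; rewrite orbT.
    have sX : (<<[:: v x; P]>> <= <<[:: v x; v i; P]>>)%VS.
      by apply: sub_span => u; rewrite !inE => /orP[]->; rewrite ?orbT.
    have := wt_cap_le c sU sX; rewrite capvC (@wt_pencil_cap c _ U x) ?dim_span //.
    + by rewrite addn0; arith.
    + by in_span.
    + by in_span.
  - by rewrite addn0; apply: leq_trans (wt_cut_le _ _ _) (ltW W PW dW).
have [le1|] := leqP (wt c fullv) (wt c <<[:: P; v x]>>).
  apply: (finish <<[:: v x]>>%VS) => //; first by in_span.
  have PR : P \in <<[:: P; v x]>>%VS by in_span.
  have := ltW _ PR (leq_trans (dim_span _) (isT : size [:: P; v x] <= 3)).
  by have := wt_cut_le c <<[:: v x]>> fullv; arith.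
case/wt_exists=> y [cy _ yx].
have Pyx : P \notin <<[:: v y; v x]>>%VS by apply: span_exchange.
have yNx : y != x by apply: contra yx => /eqP->; in_span.
have [le2|] := leqP (wt c fullv) (wt c <<[:: P; v y; v x]>>).
  apply: (finish <<[:: v y; v x]>>%VS) => //; first by in_span.
  have PR : P \in <<[:: P; v y; v x]>>%VS by in_span.
  have := ltW _ PR (dim_span _).
  by have := wt_cut_le c <<[:: v y; v x]>> fullv; arith.
case/wt_exists=> z [cz _ zyx].
have zNx : z != x by apply: contra zyx => /eqP->; in_span.
have zNy : z != y by apply: contra zyx => /eqP->; in_span.
apply: (finish <<[:: v z; v y; v x]>>%VS) => //; first by in_span.
  exact: span_exchange.
have : wt (cut c <<[:: v z; v y; v x]>>) fullv + 3 <= wt c fullv; last by arith.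
apply: (@wt_cut _ _ _ [:: z; y; x]) => [|i].
  by rewrite /= !inE negb_or zNy zNx yNx.
by rewrite !inE => /or3P[]/eqP->; split; rewrite ?memvf //; in_span.
Qed.
Lemma bounded_cut e k c U : bounded e k.+1 c ->
    (forall W : {vspace vT}, P \in W -> \dim W <= 3 -> wt c W = (2 * e + k).+1 ->
      exists i, [/\ 0 < c i, v i \in W & v i \in U]) ->
    wt (cut c U) fullv <= 3 * e + 2 * k -> bounded e k (cut c U).
Proof.
move=> [cP cU cW cT] hit cutT; split=> // [|V PV dV|W PW dW].
- exact: wt_point_cut.
- exact: leq_trans (wt_cut_le _ _ _) (cU V PV dV).
have [heavy|light] := eqVneq (wt c W) (2 * e + k).+1.
  have [i [ci iW iU]] := hit W PW dW heavy.
  have : wt (cut c U) W + 1 <= wt c W; last by rewrite heavy addn1.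
  by apply: (@wt_cut _ _ _ [:: i]) => // j; rewrite inE => /eqP->.
apply: leq_trans (wt_cut_le _ _ _) _.
by have := cW W PW dW; rewrite addnS leq_eqVlt (negPf light).
Qed.

(** In each alternative the listed subspaces intersect in the line of P alone. Hence the linear
    forms vanishing on one or another of them span all linear forms vanishing at P. *)
Definition split_bounded e k c : Prop :=
  [\/ bounded e k (cut c <<[:: P]>>),
      exists x y, [/\ x \notin <<[:: P]>>%VS, y \notin <<[:: x; P]>>%VS,
        bounded e k (cut c <<[:: x; P]>>) & bounded e k (cut c <<[:: y; P]>>)]
    | exists x y z, [/\ x \notin <<[:: P]>>%VS, y \notin <<[:: x; P]>>%VS,
        z \notin <<[:: y; x; P]>>%VS &
        [/\ bounded e k (cut c <<[:: y; x; P]>>), bounded e k (cut c <<[:: z; x; P]>>)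
          & bounded e k (cut c <<[:: z; y; P]>>)]]].

(* At most two hyperplanes through P reach weight 2e + k + 1, and then the
   support lies on them; this leaves room to choose x, y, z so that each such
   hyperplane contains two of them. *)
Lemma bounded_split e k c : bounded e k.+1 c -> split_bounded e k c.
Proof.
move=> bc; have [cP cU cW cT] := bc.
have [leT|gtT] := leqP (wt c fullv) (2 * e + k).
  constructor 1; apply: bounded_cut => // [W _ _ cWe|].
    by have := wt_sub c (subvf W); arith.
  by have := wt_cut_le c <<[:: P]>> fullv; arith.
have [|x0 [cx0 _ x0P]] := @wt_exists c fullv <<[:: P]>>; first by rewrite cP; arith.
have e_gt0 : 0 < e.
  have PU : P \in <<[:: v x0; P]>>%VS by in_span.
  have xU : v x0 \in <<[:: v x0; P]>>%VS by in_span.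
  by have := cU _ PU (dim_span _); have := wt_ge c xU; arith.
(* A heavy plane containing two of the three points shares a point with the span of P and any two of
   them, so each of the three cuts lowers it; each also lowers the total by 2. *)
have finish x y z : 0 < c x -> 0 < c y -> 0 < c z ->
    v y \notin <<[:: v x; P]>>%VS -> v z \notin <<[:: v y; v x; P]>>%VS ->
    (forall W : {vspace vT}, P \in W -> \dim W <= 3 -> wt c W = (2 * e + k).+1 ->
      [\/ (v x \in W) && (v y \in W), (v x \in W) && (v z \in W) | (v y \in W) && (v z \in W)]) ->
  split_bounded e k c.
  move=> cx cy cz yx zyx two; constructor 3; exists (v x), (v y), (v z).
  have yNx : y != x by apply: contra yx => /eqP->; in_span.
  have zNx : z != x by apply: contra zyx => /eqP->; in_span.
  have zNy : z != y by apply: contra zyx => /eqP->; in_span.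
  have cut2 (i j : 'I_s) (V : {vspace vT}) :
      0 < c i -> 0 < c j -> i != j -> v i \in V -> v j \in V ->
      wt (cut c V) fullv <= 3 * e + 2 * k.
    move=> ci cj ij iV jV; have : wt (cut c V) fullv + 2 <= wt c fullv; last by arith.
    apply: (@wt_cut _ _ _ [:: i; j]) => [|l]; first by rewrite /= inE ij.
    by rewrite !inE => /orP[]/eqP->; rewrite memvf.
  split=> //; first exact: wt_point0 cP cx.
  split; apply: bounded_cut => //.
  - move=> W PW dW /(two W PW dW)[]/andP[iW jW]; [exists x|exists x|exists y]; split=> //; in_span.
  - by apply: (cut2 y x) => //; in_span.
  - move=> W PW dW /(two W PW dW)[]/andP[iW jW]; [exists x|exists x|exists z]; split=> //; in_span.
  - by apply: (cut2 z x) => //; in_span.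
  - move=> W PW dW /(two W PW dW)[]/andP[iW jW]; [exists y|exists z|exists y]; split=> //; in_span.
  - by apply: (cut2 z y) => //; in_span.
have pick2 (W : {vspace vT}) x : (2 * e + k < wt c W) -> 0 < c x ->
    exists y, [/\ 0 < c y, v y \in W & v y \notin <<[:: v x; P]>>%VS].
  move=> heavy cx; apply: wt_exists; apply: leq_ltn_trans heavy.
  have PU : P \in <<[:: v x; P]>>%VS by in_span.
  by have := cU _ PU (dim_span _); arith.
have [[W0 [PW0 dW0 heavy0]]|noW] := classic (exists W : {vspace vT},
    [/\ P \in W, \dim W <= 3 & wt c W = (2 * e + k).+1]); last first.
  have [y [cy _ yx]] := pick2 fullv x0 gtT cx0.
  have PR : P \in <<[:: v y; v x0; P]>>%VS by in_span.
  have [|z [cz _ zyx]] := @wt_exists c fullv <<[:: v y; v x0; P]>>.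
    apply: leq_ltn_trans gtT; rewrite -ltnS ltn_neqAle.
    have := cW _ PR (dim_span _); rewrite addnS => ->; rewrite andbT.
    by apply/eqP => heavy; apply: noW; exists <<[:: v y; v x0; P]>>%VS; rewrite dim_span.
  by apply: (finish x0 y z) => // W PW dW heavy; case: noW; exists W.
have caple (W W' : {vspace vT}) :
    P \in W -> P \in W' -> \dim W <= 3 -> ~~ (W <= W')%VS -> wt c (W :&: W') <= e.
  move=> PW PW' dW nWW'; apply: cU; first by rewrite memv_cap PW.
  by rewrite -ltnS; apply: leq_trans (dim_cap_lt nWW') dW.
(* Two such planes weigh 4e + 2k + 2 together, the total is at most 3e + 2k + 2 and the intersection
   at most e, so equality holds throughout. *)
have heavy_sub (W W' : {vspace vT}) :
    wt c W = (2 * e + k).+1 -> P \in W -> P \in W' -> \dim W <= 3 ->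
    \dim W' <= 3 -> wt c W' = (2 * e + k).+1 -> ~~ (W <= W')%VS -> wt c (W :&: W') = e /\
    wt c W + wt c W' = wt c fullv + wt c (W :&: W').
  move=> hW PW PW' dW dW' hW' nWW'; have := caple W W' PW PW' dW nWW'.
  by have := wt_cap_le c (subvf W) (subvf W'); rewrite hW hW'; split; arith.
have [[W1 [PW1 dW1 heavy1 nW01]]|noW1] := classic (exists W : {vspace vT},
    [/\ P \in W, \dim W <= 3, wt c W = (2 * e + k).+1 & ~~ (W0 <= W)%VS]).
  have [capE sumE] := heavy_sub W0 W1 heavy0 PW0 PW1 dW0 dW1 heavy1 nW01.
  have dcap : \dim (W0 :&: W1) <= 2 by rewrite -ltnS; apply: leq_trans (dim_cap_lt nW01) dW0.
  have Pcap : P \in (W0 :&: W1)%VS by rewrite memv_cap PW0.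
  have [|x [cx xcap _]] := @wt_exists c (W0 :&: W1) <<[:: P]>>; first by rewrite cP capE.
  have UE := pencil_eq cP Pcap dcap cx xcap.
  have /andP[xW0 xW1] : (v x \in W0) && (v x \in W1) by rewrite -memv_cap.
  have [|y [cy yW0 yx]] := pick2 W0 x _ cx; first by rewrite heavy0.
  have [|z [cz zW1 zx]] := pick2 W1 x _ cx; first by rewrite heavy1.
  have zW0 : v z \notin W0 by apply: contra zx => zW0; rewrite -UE memv_cap zW0.
  apply: (finish x y z) => // [|W PW dW heavy].
    by apply: contra zW0; apply: subvP; span_sub.
  have [/subvP s0|n0] := boolP (W0 <= W)%VS; first by constructor 1; rewrite !s0.
  have [/subvP s1|n1] := boolP (W1 <= W)%VS; first by constructor 2; rewrite !s1.
  have onW01 i : 0 < c i -> (v i \in W0) || (v i \in W1).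
    move=> ci; apply: contraT; rewrite negb_or => /andP[i0 i1].
    by have := wt_cap_lt (subvf W0) (subvf W1) ci (memvf _) i0 i1; rewrite sumE ltnn.
  (* A heavy plane containing neither [W0] nor [W1] would meet each in weight at most e, hence weigh
     at most 2e. *)
  have := wt_le_caps W onW01; rewrite heavy ![(W :&: _)%VS]capvC.
  by have := caple _ _ PW0 PW dW0 n0; have := caple _ _ PW1 PW dW1 n1; arith.
have heavyW0 (W : {vspace vT}) : P \in W -> \dim W <= 3 -> wt c W = (2 * e + k).+1 -> (W0 <= W)%VS.
  by move=> PW dW hW; apply: contraT => nW0; case: noW1; exists W.
have [|x [cx xW0 xP]] := @wt_exists c W0 <<[:: P]>>; first by rewrite cP heavy0.
have [|y [cy yW0 yx]] := pick2 W0 x _ cx; first by rewrite heavy0.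
(* If [W0] carries all the weight, there is no third point [z]; but the total is then 2e + k + 1,
   and cutting along a line, which removes one point, suffices. *)
have [leT|/wt_exists[z [cz _ zW0]]] := leqP (wt c fullv) (wt c W0).
  have cut1 (i : 'I_s) (V : {vspace vT}) :
      0 < c i -> v i \in V -> wt (cut c V) fullv <= 3 * e + 2 * k.
    move=> ci iV; have : wt (cut c V) fullv + 1 <= wt c fullv; last by arith.
    by apply: (@wt_cut _ _ _ [:: i]) => // l; rewrite inE => /eqP->; rewrite memvf.
  constructor 2; exists (v x), (v y); split=> //.
    apply: bounded_cut => // [W PW dW /(heavyW0 W PW dW)/subvP sW|].
      by exists x; split; rewrite ?sW //; in_span.
    by apply: (cut1 x) => //; in_span.
  apply: bounded_cut => // [W PW dW /(heavyW0 W PW dW)/subvP sW|].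
    by exists y; split; rewrite ?sW //; in_span.
  by apply: (cut1 y) => //; in_span.
apply: (finish x y z) => // [|W PW dW /(heavyW0 W PW dW)/subvP sW].
  by apply: contra zW0; apply: subvP; span_sub.
by constructor 1; rewrite !sW.
Qed.

End Pencil.
End Weights.

Local Open Scope ring_scope.

(** * Interpolation under the Segre bounds *)

Section SegreBound.
Variables (K : closedFieldType) (n s : nat) (v : 'I_s -> 'rV[K]_n).
Implicit Types (f g : {mpoly K[n]}) (a : 'rV[K]_n) (c m : 'I_s -> nat).
Implicit Types (U W : {vspace 'rV[K]_n}).

Lemma linform_span0 a (X : seq 'rV[K]_n) :
    (forall x, x \in X -> ev (linform a) x = 0) ->
  forall u, u \in <<X>>%VS -> ev (linform a) u = 0.
Proof.
elim: X => [|x X IHX] aX u.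
  by rewrite span_nil memv0 => /eqP->; rewrite -(scale0r 0) linform_evalZ mul0r.
rewrite span_cons => /memv_addP[y /vlineP[b ->] [w wX ->]].
rewrite linform_evalD linform_evalZ aX ?mem_head // mulr0 add0r.
by apply: IHX wX => z zX; rewrite aX // inE zX orbT.
Qed.

Lemma vanishing_cut a U c f i : (forall u, u \in U -> ev (linform a) u = 0) ->
  vanishing (v i) (cut v c U i) f -> vanishing (v i) (c i) (linform a * f).
Proof.
move=> aU; rewrite /cut.
have [/aU av|_] := boolP (v i \in U); last by rewrite subn0; apply: ideal_exp_Ml.
case: (c i) => [|k]; first by move=> _; apply: ideal_exp_exp0.
by rewrite subn1; apply: ideal_exp_S; apply: point_ideal_linform.
Qed.

Section AtPoint.
Variables (P a0 : 'rV[K]_n).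
Local Notation h := (linform a0).
Hypothesis hP : ev h P = 1.

Lemma normalized_neq0 : P != 0.
Proof.
apply: contra_eq_neq hP => ->; rewrite -(scale0r 0) linform_evalZ mul0r.
by rewrite eq_sym oner_neq0.
Qed.

Lemma coverable_form e c : coverable v P e c ->
  exists f, [/\ f \is e.-homog, forall i, vanishing (v i) (c i) f
    & vanishing P 1 (f - h ^+ e)].
Proof.
elim: e c => [|e IHe] c /=.
  move=> c0; exists 1; split=> [|i|]; first exact: dhomog1.
    by rewrite c0; apply: ideal_exp_exp0.
  by rewrite subrr; apply: ideal_exp_0.
move=> [U PU /IHe[f [hf vf fP]]].
have [a [aU aP]] := separating_linform PU.
exists (linform a * f); split; last 1 first.
- have -> : linform a * f - h ^+ e.+1 = linform a * (f - h ^+ e) + linform (a - a0) * h ^+ e.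
    by rewrite linearB /= exprS; ring.
  apply: ideal_exp_D; first exact: ideal_exp_Ml.
  apply: ideal_exp_S; last exact: ideal_exp_exp0.
  by apply: point_ideal_linform; rewrite linearB mevalB aP hP subrr.
- by rewrite -add1n dhomogM ?linform_homog.
- by move=> i; apply: vanishing_cut aU (vf i).
Qed.

(* Every linear form vanishing at P is a sum of linear forms vanishing on the
   hyperplanes provided by [bounded_split]. *)
Lemma bounded_form k phi : linprod P k phi -> forall e c, bounded v P e k c ->
  exists f, [/\ f \is (k + e).-homog, forall i, vanishing (v i) (c i) f
    & vanishing P k.+1 (f - phi * h ^+ e)].
Proof.
elim=> {k phi} [z|k|k phi psi _ IHphi _ IHpsi|k a phi aP _ IHphi] e c bc.
- have [f [hf vf fP]] := coverable_form (coverable_bounded normalized_neq0 bc).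
  exists (z%:MP * f); split=> [|i|].
  + by rewrite mul_mpolyC rpredZ.
  + exact: ideal_exp_Ml.
  + by rewrite -mulrBr; apply: ideal_exp_Ml.
- exists 0; split=> [|i|]; first exact: dhomog0.
    exact: ideal_exp_0.
  by rewrite mul0r subrr; apply: ideal_exp_0.
- have [f [hf vf fP]] := IHphi e c bc; have [g [hg vg gP]] := IHpsi e c bc.
  exists (f + g); split=> [|i|]; first exact: rpredD.
    exact: ideal_exp_D.
  have -> : f + g - (phi + psi) * h ^+ e = (f - phi * h ^+ e) + (g - psi * h ^+ e) by ring.
  exact: ideal_exp_D.
(* The claim with first factor [linform b]. It is additive in [b], so [a] may be decomposed. *)
pose good b := exists f, [/\ f \is (k.+1 + e).-homog, forall i, vanishing (v i) (c i) f
    & vanishing P k.+2 (f - linform b * phi * h ^+ e)].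
have good_cut b (X : seq 'rV[K]_n) : (forall x, x \in X -> ev (linform b) x = 0) -> P \in X ->
    bounded v P e k (cut v c <<X>>) -> good b.
  move=> bX PX /IHphi[f [hf vf fP]]; exists (linform b * f); split.
  - by rewrite addSn -add1n dhomogM ?linform_homog.
  - by move=> i; apply: vanishing_cut (linform_span0 bX) (vf i).
  - rewrite -mulrA -mulrBr; apply: ideal_exp_S fP.
    by apply: point_ideal_linform; apply: bX.
have goodD b b' : good b -> good b' -> good (b + b').
  move=> [f [hf vf fP]] [g [hg vg gP]]; exists (f + g); split=> [|i|]; first exact: rpredD.
    exact: ideal_exp_D.
  have -> : f + g - linform (b + b') * phi * h ^+ e =
      (f - linform b * phi * h ^+ e) + (g - linform b' * phi * h ^+ e).
    by rewrite linearD /=; ring.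
  exact: ideal_exp_D.
have evB (b b' x : 'rV[K]_n) : ev (linform (b - b')) x = ev (linform b) x - ev (linform b') x.
  by rewrite linearB mevalB.
have evZ z (b x : 'rV[K]_n) : ev (linform (z *: b)) x = z * ev (linform b) x.
  by rewrite linearZ mevalZ.
case: (bounded_split normalized_neq0 bc) =>
  [bP|[x [y [xP yxP bx by_]]]|[x [y [z [xP yxP zyxP [byx bzx bzy]]]]]].
- by apply: good_cut bP => [x|]; rewrite inE // => /eqP->.
- have xyP := span_exchange xP yxP.
  have [b [bX bx1]] := separating_linform xyP.
  have [b0 bP] : ev (linform b) y = 0 /\ ev (linform b) P = 0 by split; apply: bX; in_span.
  (* The difference of [a] and the multiple of [b] vanishes at [x] and [P], while [b] vanishes at
     [y] and [P]. *)
  rewrite -(subrK (ev (linform a) x *: b) a); apply: goodD.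
    apply: good_cut bx => [u|]; last by rewrite !inE eqxx orbT.
    by rewrite !inE evB evZ => /orP[]/eqP->; rewrite ?bx1 ?bP ?aP; ring.
  apply: good_cut by_ => [u|]; last by rewrite !inE eqxx orbT.
  by rewrite !inE evZ => /orP[]/eqP->; rewrite ?b0 ?bP mulr0.
- have xyP := span_exchange xP yxP.
  have xzyP : x \notin <<[:: z; y; P]>>%VS.
    apply: span_exchange xyP _.
    by rewrite (@eq_span _ _ _ [:: y; x; P]) // => u; rewrite !inE orbCA.
  have yzxP := span_exchange yxP zyxP.
  have [b [bX bx1]] := separating_linform xzyP.
  have [b' [b'X by1]] := separating_linform yzxP.
  have [bz [by0 bP]] : ev (linform b) z = 0 /\ ev (linform b) y = 0 /\ ev (linform b) P = 0.
    by split; last split; apply: bX; in_span.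
  have [b'z [b'x b'P]] : ev (linform b') z = 0 /\ ev (linform b') x = 0 /\ ev (linform b') P = 0.
    by split; last split; apply: b'X; in_span.
  (* [a - bb] vanishes at x, y, P; the multiple of [b'] at z, x, P; the multiple of [b] at z, y,
     P. *)
  pose bb := ev (linform a) x *: b + ev (linform a) y *: b'.
  rewrite -(subrK bb a); apply: (goodD); last apply: (goodD).
  + apply: good_cut byx => [u|]; last by rewrite !inE eqxx !orbT.
    have evbb (w : 'rV[K]_n) : ev (linform bb) w =
        ev (linform a) x * ev (linform b) w + ev (linform a) y * ev (linform b') w.
      by rewrite linearD mevalD !evZ.
    by rewrite !inE evB evbb => /or3P[]/eqP->; rewrite ?bx1 ?by0 ?bP ?by1 ?b'x ?b'P ?aP; ring.
  + apply: good_cut bzy => [u|]; last by rewrite !inE eqxx !orbT.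
    by rewrite !inE evZ => /or3P[]/eqP->; rewrite ?bz ?by0 ?bP mulr0.
  + apply: good_cut bzx => [u|]; last by rewrite !inE eqxx !orbT.
    by rewrite !inE evZ => /or3P[]/eqP->; rewrite ?b'z ?b'x ?b'P mulr0.
Qed.

End AtPoint.

(* The targets are degree-d forms instead of arbitrary jets at the fat points;
   by [vanishing_divide] this is no restriction when all m i <= d + 1. *)
Definition interpolates d m : Prop :=
  forall g : 'I_s -> {mpoly K[n]}, (forall i, g i \is d.-homog) ->
  exists2 f, f \is d.-homog & forall i, vanishing (v i) (m i) (f - g i).

Hypothesis v_neq0 : forall i, v i != 0.
Hypothesis v_inj : forall i j, v i \in <[v j]>%VS -> i = j.

Theorem segre_interpolates d m :
    (wt v m fullv <= 3 * d + 1)%N ->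
    (forall L, (\dim L <= 2)%N -> (wt v m L <= d + 1)%N) ->
    (forall L, (\dim L <= 3)%N -> (wt v m L <= 2 * d + 1)%N) ->
  interpolates d m.
Proof.
have [N] := ubnP (wt v m fullv); elim: N m => // N IHN m ltN wT wL wH g hg.
have [/forallP m0|] := boolP [forall i, m i == 0%N].
  exists 0; first exact: dhomog0.
  by move=> i; rewrite (eqP (m0 i)); apply: ideal_exp_exp0.
rewrite negb_forall => /existsP[i0]; rewrite -lt0n => mi0.
(* After solving for [m'], only the leading term at P is wrong. The correction has to vanish to full
   order at all other points, which is what [c] records. *)
set P := v i0; pose m' i := (m i - (i == i0))%N.
pose c i := if i == i0 then 0%N else m i.
have wtm' W : (wt v m' W <= wt v m W)%N by apply: wt_le => i; apply: leq_subr.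
have wtE W : P \in W -> wt v m W = (m i0 + wt v c W)%N.
  move=> PW; rewrite /wt (bigD1 i0) //= [in RHS](bigD1 i0) //= /c eqxx add0n.
  by congr (_ + _)%N; apply: eq_bigr => i /andP[_ /negPf->].
have ltm' : (wt v m' fullv < wt v m fullv)%N.
  rewrite /wt [ltnRHS](bigD1 i0) ?memvf // [ltnLHS](bigD1 i0) ?memvf //= /m' eqxx subn1.
  rewrite -addSn prednK // leq_add2l; apply: leq_sum => i _; exact: leq_subr.
have [f hf vf] : exists2 f, f \is d.-homog & forall i, vanishing (v i) (m' i) (f - g i).
  apply: IHN hg => [||L dL|L dL]; first exact: leq_trans ltm' _.
  - exact: leq_trans (wtm' _) wT.
  - exact: leq_trans (wtm' _) (wL L dL).
  - exact: leq_trans (wtm' _) (wH L dL).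
have [|a0 [_ hP]] := @separating_linform _ _ 0%VS P; first by rewrite memv0 v_neq0.
pose k := (m i0).-1.
have PP : P \in <[P]>%VS := memv_line P.
have lekd : (k <= d)%N.
  have := wL <[P]>%VS; rewrite dim_vline (wtE _ PP).
  move=> /(_ (leq_trans (leq_b1 _) (isT : (1 <= 2)%N))).
  by rewrite /k; clear -mi0; lia.
have hgf : g i0 - f \is d.-homog by rewrite rpredB.
have vgf : vanishing P k (g i0 - f).
  by rewrite -opprB; apply: ideal_exp_N; have := vf i0; rewrite /m' eqxx subn1.
have [phi Lphi vphi] := vanishing_lead hP hgf lekd vgf.
have bc : bounded v P (d - k) k c.
  split=> [|U PU dU|W PW dW|].
  - rewrite span_seq1 /wt big1 // => i /v_inj ->; by rewrite /c eqxx.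
  - by have := wL U dU; rewrite (wtE _ PU) /k; clear -mi0 lekd; lia.
  - by have := wH W dW; rewrite (wtE _ PW) /k; clear -mi0 lekd; lia.
  - by have := wT; rewrite (wtE _ (memvf _)) /k; clear -mi0 lekd; lia.
have [F [hF vF FP]] := bounded_form hP Lphi bc.
exists (f + F).
  by rewrite rpredD //; move: hF; rewrite subnKC.
move=> i; have [->|ii0] := eqVneq i i0.
  have -> : f + F - g i0 =
    (F - phi * linform a0 ^+ (d - k)) - (g i0 - f - linform a0 ^+ (d - k) * phi) by ring.
  by rewrite -(prednK mi0); apply: ideal_exp_B.
rewrite addrAC; apply: ideal_exp_D.
  by have := vf i; rewrite /m' (negPf ii0) subn0.
by have := vF i; rewrite /c (negPf ii0).
Qed.

End SegreBound.

(** * Cech cohomology *)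

Section Monomials.
Variables (K : fieldType) (n : nat).
Implicit Types (A B C u l r : {mpoly K[n]}) (i j k : 'I_n) (mm : 'X_{1..n}).

Lemma mem_msuppXnM i a A mm :
  (mm \in msupp ('X_i ^+ a * A)) = (mm \in [seq (U_(i) *+ a + m')%MM | m' <- msupp A]).
Proof. by rewrite mpolyXn mulrC (perm_mem (msuppMX _ _)). Qed.

Lemma msuppXnM i a A mm : mm \in msupp A -> (U_(i) *+ a + mm)%MM \in msupp ('X_i ^+ a * A).
Proof. by move=> mA; rewrite mem_msuppXnM map_f. Qed.

Lemma msuppXnM_ge i a A mm : mm \in msupp ('X_i ^+ a * A) -> (a <= mm i)%N.
Proof.
rewrite mem_msuppXnM => /mapP[m' _ ->].
by rewrite mnmDE mulmnE mnm1E eqxx mul1n leq_addr.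
Qed.

Lemma mpolyX_expD_neq0 i a : 'X_i ^+ a != 0 :> {mpoly K[n]}.
Proof. by rewrite expf_neq0 // -msupp_eq0 msuppX. Qed.

Lemma dhomog_XnM i a A D : ('X_i ^+ a * A \is (D + a).-homog) = (A \is D.-homog).
Proof.
apply/idP/idP => [/dhomogP hA|hA].
  apply/dhomogP => mm /(msuppXnM i a)/hA /=.
  by rewrite mdegD mdegMn mdeg1 mul1n addnC => /addIn.
by rewrite addnC dhomogM // -[a in a.-homog]mul1n dhomogMn // dhomogX /= mdeg1.
Qed.

Lemma msupp_filter (Q : pred 'X_{1..n}) A mm :
    mm \in msupp (\sum_(m' <- msupp A | Q m') A@_m' *: 'X_[m']) ->
  Q mm && (mm \in msupp A).
Proof.
apply: contraTT => nQ; rewrite -mcoeff_eq0 raddf_sum big1_seq //= => m' /andP[Qm' m'A].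
rewrite mcoeffZ mcoeffX; have [eqm|_] := eqVneq m' mm; last by rewrite mulr0.
by rewrite -eqm Qm' m'A in nQ.
Qed.

Lemma Xn_dvd j b A : (forall mm, mm \in msupp A -> (b <= mm j)%N) ->
  exists C, A = 'X_j ^+ b * C.
Proof.
move=> bA; exists (\sum_(mm <- msupp A) A@_mm *: 'X_[mm - U_(j) *+ b]).
rewrite {1}(mpolyE A) mulr_sumr !big_seq; apply: eq_bigr => mm mA.
rewrite -scalerAr mpolyXn -mpolyXD addmC submK //.
apply/mnm_lepP => i; rewrite mulmnE mnm1E; case: eqP => [<-|_] //.
by rewrite mul1n bA.
Qed.

Lemma Xn_dvd_mul i j a b A B : i != j -> 'X_i ^+ a * A = 'X_j ^+ b * B ->
  exists C, A = 'X_j ^+ b * C.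
Proof.
move=> ij AB; apply: Xn_dvd => mm /(msuppXnM i a); rewrite AB => /msuppXnM_ge.
by rewrite mnmDE mulmnE mnm1E (negPf ij) mul0n.
Qed.

Lemma Xn_split i N u : exists l r, [/\ u = l + 'X_i ^+ N * r,
  forall mm, mm \in msupp l -> (mm i < N)%N & {subset msupp l <= msupp u}].
Proof.
pose part Q := \sum_(mm <- msupp u | Q mm) u@_mm *: 'X_[mm].
have [|r rE] := @Xn_dvd i N (part (fun mm => ~~ (mm i < N)%N)).
  by move=> mm /msupp_filter /andP[]; rewrite -leqNgt.
exists (part (fun mm => (mm i < N)%N)), r.
split=> [|mm /msupp_filter/andP[]//|mm /msupp_filter/andP[]//].
by rewrite -rE {1}(mpolyE u) (bigID (fun mm => (mm i < N)%N)).
Qed.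

Lemma low_eq0 i N A r : (forall mm, mm \in msupp A -> (mm i < N)%N) ->
  A = 'X_i ^+ N * r -> A = 0.
Proof.
move=> lowA AE; apply/eqP; rewrite -msupp_eq0; case E : (msupp A) => [|mm ?] //.
have mA : mm \in msupp A by rewrite E mem_head.
by have := lowA mm mA; rewrite ltnNge (@msuppXnM_ge i N r) // -AE.
Qed.

(* Vanishing of H^1 of the twists of the structure sheaf, cleared of
   denominators: c_ij = f_ij / (x_i x_j)^N and b_i = r_i / x_i^N. *)
Lemma cech_structure_sheaf D N (f : 'I_n -> 'I_n -> {mpoly K[n]}) : (2 < n)%N ->
    (forall i j, i != j -> f i j \is (D + N + N).-homog) ->
    (forall i j, i != j -> f j i = - f i j) ->
    (forall i j k, i != j -> i != k -> j != k ->
      'X_i ^+ N * f j k - 'X_j ^+ N * f i k + 'X_k ^+ N * f i j = 0) ->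
  exists r : 'I_n -> {mpoly K[n]}, (forall i, r i \is (D + N).-homog) /\
    forall i j, i != j -> f i j = 'X_i ^+ N * r j - 'X_j ^+ N * r i.
Proof.
move=> n_gt2 hf fA fC.
pose i0 : 'I_n := Ordinal (ltnW (ltnW n_gt2)).
pose i1 : 'I_n := Ordinal (ltnW n_gt2); pose i2 : 'I_n := Ordinal n_gt2.
have [l lP] := fin_all_exists (fun j => Xn_split i0 N (f i0 j)).
have [r rP] := fin_all_exists lP.
have fE j : f i0 j = l j + 'X_i0 ^+ N * r j by have [] := rP j.
have lowl j mm : mm \in msupp (l j) -> (mm i0 < N)%N by have [_ + _] := rP j; apply.
have hl j : i0 != j -> l j \is (D + N + N).-homog.
  by move=> j0; have [_ _ sl] := rP j; apply/dhomogP => mm /sl; apply/dhomogP/hf.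
have hr j : i0 != j -> r j \is (D + N).-homog.
  move=> j0; rewrite -(dhomog_XnM i0 N).
  have -> : 'X_i0 ^+ N * r j = f i0 j - l j by rewrite fE addrC addKr.
  by rewrite rpredB ?hl ?hf.
(* Modulo ['X_i0 ^+ N] the cocycle identity involves only the [l j], and their low degree in ['X_i0]
   turns the congruence into an equality. *)
have lE j k : i0 != j -> i0 != k -> j != k -> 'X_j ^+ N * l k = 'X_k ^+ N * l j.
  move=> j0 k0 jk; apply/eqP; rewrite -subr_eq0; apply/eqP.
  apply: (@low_eq0 i0 N _ (f j k - 'X_j ^+ N * r k + 'X_k ^+ N * r j)) => [mm|].
    move/msuppB_le; rewrite mem_cat !mem_msuppXnM => /orP[]/mapP[m' /lowl lt ->].
      by rewrite mnmDE mulmnE mnm1E [j == _]eq_sym (negPf j0) mul0n.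
    by rewrite mnmDE mulmnE mnm1E [k == _]eq_sym (negPf k0) mul0n.
  have := fC i0 j k j0 k0 jk; rewrite !fE => fC0.
  have -> : 'X_j ^+ N * l k - 'X_k ^+ N * l j =
    'X_i0 ^+ N * (f j k - 'X_j ^+ N * r k + 'X_k ^+ N * r j) -
    ('X_i0 ^+ N * f j k - 'X_j ^+ N * (l k + 'X_i0 ^+ N * r k) +
      'X_k ^+ N * (l j + 'X_i0 ^+ N * r j)) by ring.
  by rewrite fC0 subr0.
(* Powers of two different variables are coprime, so all [l j] share one quotient [w]; then [- w]
   serves as the section at [i0]. *)
have [w wE] := @Xn_dvd_mul i2 i1 N N (l i1) (l i2) isT (lE i2 i1 isT isT isT).
have lw j : i0 != j -> l j = 'X_j ^+ N * w.
  move=> j0; have [->//|j1] := eqVneq j i1.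
  apply: (mulfI (mpolyX_expD_neq0 i1 N)).
  by rewrite (lE i1 j) // 1?eq_sym // wE mulrCA.
pose r' j := if j == i0 then - w else r j.
exists r'; split=> [j|].
  rewrite /r'; have [_|j0] := eqVneq j i0; last by rewrite hr // eq_sym.
  by rewrite rpredN -(dhomog_XnM i1 N) -lw // hl.
have main j : i0 != j -> f i0 j = 'X_i0 ^+ N * r' j - 'X_j ^+ N * r' i0.
  by move=> j0; rewrite /r' eqxx eq_sym (negPf j0) fE lw //; ring.
move=> i j ij; have [i_0|i0i] := eqVneq i0 i.
  by rewrite -i_0 main // i_0.
have [j_0|i0j] := eqVneq i0 j.
  by rewrite -j_0 fA // main //; ring.
apply: (mulfI (mpolyX_expD_neq0 i0 N)).
have := fC i0 i j i0i i0j ij; rewrite !main // => /eqP; rewrite addr_eq0 subr_eq => /eqP->.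
by ring.
Qed.

End Monomials.

Section Fractions.

Lemma cech_field (F : fieldType) (a b x y : F) : x != 0 -> y != 0 ->
  (x * b - y * a) / (x * y) = b / y - a / x.
Proof. by move=> x0 y0; field; rewrite x0 y0. Qed.

Lemma cleared_cocycle (F : fieldType) (x y z a b c : F) :
  a - b + c = 0 -> x * (a * (y * z)) - y * (b * (x * z)) + z * (c * (x * y)) = 0.
Proof.
move=> abc; have -> : x * (a * (y * z)) - y * (b * (x * z)) + z * (c * (x * y)) =
  x * y * z * (a - b + c) by ring.
by rewrite abc mulr0.
Qed.

Variable R : idomainType.
Implicit Types (a b x y : R).

Lemma tofrac_cech a b x y : x != 0 -> y != 0 ->
  tofrac (x * b - y * a) / (tofrac x * tofrac y) = tofrac b / tofrac y - tofrac a / tofrac x.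
Proof. by move=> x0 y0; rewrite tofracB !tofracM cech_field // tofrac_eq0. Qed.

Lemma tofrac_cancel a x y : y != 0 -> tofrac (a * y) / tofrac (x * y) = tofrac a / tofrac x.
Proof.
move=> y0; rewrite !tofracM invfM mulrACA divff ?mulr1 //.
by rewrite tofrac_eq0.
Qed.

End Fractions.

Section Cech.
Variables (K : closedFieldType) (n s : nat) (v : 'I_s -> 'rV[K]_n).
Variables (p : 'I_s -> {vspace 'rV[K]_n}) (m : 'I_s -> nat) (d : nat).
Hypothesis v_neq0 : forall i, v i != 0.
Hypothesis pE : forall i, p i = <[v i]>%VS.

Lemma fat_idealP f : fat_ideal p m f <-> forall i, vanishing (v i) (m i) f.
Proof. by split=> H i; have := H i; rewrite pE. Qed.

Lemma prod_set2 (i j : 'I_n) (F : 'I_n -> {mpoly K[n]}) : i != j ->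
  \prod_(l in [set i; j]) F l = F i * F j.
Proof. by move=> ij; rewrite big_setU1 ?big_set1 // inE. Qed.

(** The sequence H^0(O(d)) -> H^0(O_Z(d)) -> H^1(I_Z(d)) -> H^1(O(d)) = 0 made explicit. A cocycle
    bounds a cochain of O(d), which induces a section over Z; interpolation lifts that section to a
    form [phi], and subtracting [phi] moves the cochain into the ideal. *)
Lemma interpolates_H1 : (2 < n)%N -> (forall i, (m i <= d.+1)%N) ->
  interpolates v d m -> H1_vanishes (fat_ideal p m) d.
Proof.
move=> n_gt2 md interp c secc cocy.
have [k0 kP] := fin_all_exists (fun i => fin_all_exists (secc i)).
have [f0 fP] := fin_all_exists (fun i => fin_all_exists (kP i)).
pose N := (\sum_i \sum_j k0 i j)%N.
have leN i j : (k0 i j <= N)%N.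
  by rewrite /N (bigD1 i) //= (bigD1 j) //= -addnA leq_addr.
pose x i : {fraction {mpoly K[n]}} := tofrac ('X_i ^+ N).
have x0 i : x i != 0 by rewrite tofrac_eq0 mpolyX_expD_neq0.
have [f [If hf cE]] : exists f : 'I_n -> 'I_n -> {mpoly K[n]},
    [/\ forall i j, fat_ideal p m (f i j),
        forall i j, i != j -> f i j \is (d + N + N).-homog
      & forall i j, i != j -> c i j = tofrac (f i j) / (x i * x j)].
  exists (fun i j => f0 i j * ('X_i * 'X_j) ^+ (N - k0 i j)); split=> i j => [|ij|ij].
  - apply/fat_idealP => l; have [/fat_idealP/(_ l) vf _ _] := fP i j.
    by rewrite mulrC; apply: ideal_exp_Ml.
  - have [_ hf0 _] := fP i j; move: hf0; rewrite cards2 ij => hf0.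
    have -> : (d + N + N = d + k0 i j * 2 + 2 * (N - k0 i j))%N.
      by have := leN i j; clear; lia.
    by rewrite dhomogM // dhomogMn // -(addn1 1) dhomogM // dhomogX /= mdeg1.
  - have [_ _ ->] := fP i j; rewrite prod_set2 // -tofracM -exprMn.
    rewrite -{2}(subnKC (leN i j)) exprD; apply/esym/tofrac_cancel.
    by rewrite exprMn mulf_neq0 ?mpolyX_expD_neq0.
have c0 i : c i i = 0 by have := cocy i i i; rewrite subrr add0r.
have cA i j : c j i = - c i j.
  by have := cocy i j i; rewrite c0 subr0 => /eqP; rewrite addr_eq0 => /eqP.
have fE i j : i != j -> tofrac (f i j) = c i j * (x i * x j).
  by move=> ij; rewrite cE // divfK // mulf_neq0.
have [||r [hr rE]] := cech_structure_sheaf n_gt2 hf.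
- move=> i j ij; have ji : j != i by rewrite eq_sym.
  apply/eqP; rewrite -tofrac_eq rmorphN /= (fE _ _ ij) (fE _ _ ji) (cA i j).
  by rewrite mulNr [x j * _]mulrC.
- move=> i j k ij ik jk; apply/eqP; rewrite -tofrac_eq0.
  rewrite tofracD tofracB !tofracM !fE //; apply/eqP.
  exact: cleared_cocycle (cocy i j k).
(* [g] represents the section [r k / 'X_k ^+ N] near [v i], in a chart [k] containing that point. *)
have gP i : exists g, g \is d.-homog /\
    exists k, v i 0 k != 0 /\ vanishing (v i) (m i) (r k - 'X_k ^+ N * g).
  have [k vk] : exists k, v i 0 k != 0.
    apply/existsP; rewrite -negb_forall; apply: contra (v_neq0 i) => /forallP vi0.
    by apply/eqP/rowP => j; rewrite [RHS]mxE; apply/eqP.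
  have [||g hg vg] := @vanishing_divide _ _ (v i) (delta_mx 0 k) d N (m i) (r k) _ (hr k).
  - by rewrite linform_delta mevalXU.
  - exact: md.
  by exists g; split=> //; exists k; rewrite -linform_delta.
have [g gP'] := fin_all_exists gP.
have [phi hphi vphi] := interp g (fun i => (gP' i).1).
have vr i j : vanishing (v i) (m i) (r j - 'X_j ^+ N * phi).
  have [_ [k [vk vg]]] := gP' i.
  have vrk : vanishing (v i) (m i) (r k - 'X_k ^+ N * phi).
    have -> : r k - 'X_k ^+ N * phi = r k - 'X_k ^+ N * g i - 'X_k ^+ N * (phi - g i) by ring.
    by apply: ideal_exp_B => //; apply: ideal_exp_Ml.
  have [->//|jk] := eqVneq j k.
  (* Passage from chart [k] to chart [j]: after multiplication by the unit ['X_k ^+ N], the two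
     errors differ by [f k j], which lies in the ideal. *)
  apply: (@vanishing_cancel _ _ (v i) (delta_mx 0 k) (d + N) N).
  - by rewrite linform_delta mevalXU.
  - by apply: rpredB; [apply: hr | rewrite dhomog_XnM].
  have -> : linform (delta_mx 0 k) ^+ N * (r j - 'X_j ^+ N * phi) =
      f k j + 'X_j ^+ N * (r k - 'X_k ^+ N * phi).
    by rewrite rE 1?eq_sym // linform_delta; ring.
  by apply: ideal_exp_D; [have /fat_idealP := If k j; apply | apply: ideal_exp_Ml].
exists (fun j => tofrac (r j - 'X_j ^+ N * phi) / x j) => [j|i j].
  exists N, (r j - 'X_j ^+ N * phi); split; first exact/fat_idealP.
    by rewrite cards1 muln1; apply: rpredB; [apply: hr | rewrite dhomog_XnM].
  by rewrite big_set1.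
have [->|ij] := eqVneq i j; first by rewrite c0 subrr.
rewrite cE // rE // /x -tofrac_cech ?mpolyX_expD_neq0 //.
congr (tofrac _ / _); ring.
Qed.

End Cech.

(** * Restriction to a subspace *)

Lemma cross_mul (F : fieldType) (x y a b : F) : x != 0 -> y != 0 ->
  b / x = a / y -> x * a = y * b.
Proof. by move=> x0 y0 E; rewrite -(divfK y0 a) -E; field. Qed.

Lemma clear_error (R : comNzRingType) (y a b c : R) M N :
  y ^+ M * a - y ^+ N * c - y ^+ (N + M) * b = y ^+ M * (a - y ^+ N * b) - y ^+ N * c.
Proof. by rewrite mulrBr mulrA -exprD addnC addrAC. Qed.

Lemma telescope3 (V : zmodType) (x y z : V) : (z - y) - (z - x) + (y - x) = 0.
Proof. by rewrite opprB [z - y + _]addrC !subrKA subrr. Qed.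

Section Restriction.
Variables (K : closedFieldType) (n : nat) (L : {vspace 'rV[K]_n}).
Implicit Types (f g : {mpoly K[n]}) (v : 'rV[K]_n) (k l : 'I_(\dim L)).

Local Notation rc := (restrict_coord L).

(** [coord] is linear on the whole space, so this gives a linear form on K^n extending the k-th
    coordinate of L. *)
Definition plane_coord k : 'rV[K]_n := \row_j coord (vbasis L) k (delta_mx 0 j).
Definition plane_coords : (\dim L).-tuple {mpoly K[n]} :=
  [tuple linform (plane_coord k) | k < \dim L].

(* Restriction to L followed by pull-back along a linear projection onto L. *)
Definition retract f : {mpoly K[n]} := (f \mPo rc) \mPo plane_coords.

Lemma retract_is_zmod_morphism : zmod_morphism retract.
Proof. by move=> f g; rewrite /retract !rmorphB. Qed.
HB.instance Definition _ := GRing.isZmodMorphism.Build _ _ retract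
  retract_is_zmod_morphism.
Lemma retract_is_monoid_morphism : monoid_morphism retract.
Proof. by split=> [|f g]; rewrite /retract ?rmorph1 ?rmorphM. Qed.
HB.instance Definition _ := GRing.isMonoidMorphism.Build _ _ retract
  retract_is_monoid_morphism.

Lemma plane_coord_eval k v : ev (linform (plane_coord k)) v = coord (vbasis L) k v.
Proof. exact: linform_eval_scalar. Qed.

Lemma restrict_coord_homog j : tnth rc j \is 1.-homog.
Proof.
rewrite tnth_mktuple; apply: rpred_sum => k _.
by rewrite rpredZ // dhomogX /= mdeg1.
Qed.

Lemma plane_coords_homog k : tnth plane_coords k \is 1.-homog.
Proof. by rewrite tnth_mktuple linform_homog. Qed.

Lemma retract_homog D f : f \is D.-homog -> retract f \is D.-homog.
Proof.
move=> hf; apply: dhomog_comp plane_coords_homog _.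
exact: dhomog_comp restrict_coord_homog hf.
Qed.

Lemma restrict_plane_coord k : linform (plane_coord k) \mPo rc = 'X_k.
Proof.
rewrite /linform rmorph_sum /=.
under eq_bigr => j _ do rewrite comp_mpolyZ comp_mpolyXU -tnth_nth tnth_mktuple scaler_sumr.
rewrite exchange_big /= (bigD1 k) //= [X in _ + X]big1 ?addr0 => [|l lk].
  under eq_bigr do rewrite scalerA.
  rewrite -scaler_suml -linform_eval plane_coord_eval (tnth_nth 0).
  by rewrite coord_free ?eqxx ?scale1r // (basis_free (vbasisP L)).
under eq_bigr do rewrite scalerA.
rewrite -scaler_suml -linform_eval plane_coord_eval (tnth_nth 0).
by rewrite coord_free ?(basis_free (vbasisP L)) // (negPf lk) scale0r.
Qed.

Lemma retract_plane_coord k : retract (linform (plane_coord k)) = linform (plane_coord k).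
Proof. by rewrite /retract restrict_plane_coord comp_mpolyXU -tnth_nth tnth_mktuple. Qed.

Lemma retract_eval f v : v \in L -> ev (retract f) v = ev f v.
Proof.
move=> vL; rewrite /retract !comp_mpoly_meval; apply: meval_eq => j.
rewrite tnth_mktuple raddf_sum /= [in RHS](coord_vbasis vL) summxE.
apply: eq_bigr => k _; rewrite mevalZ mevalXU tnth_mktuple plane_coord_eval.
by rewrite mxE mulrC (tnth_nth 0).
Qed.

Lemma retract_vanishing v m f : v \in L -> vanishing v m f -> vanishing v m (retract f).
Proof.
move=> vL; apply: (@ideal_exp_map _ _ _ _ retract) => g vg u uv.
by rewrite retract_eval ?vg //; move/vlineP: uv => [c ->]; apply: memvZ.
Qed.

Lemma plane_coord_neq0 v : v != 0 -> v \in L -> exists k, ev (linform (plane_coord k)) v != 0.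
Proof.
move=> v0 vL; apply/existsP; rewrite -negb_forall; apply: contra v0 => /forallP v0.
rewrite (coord_vbasis vL) big1 // => k _.
by have := v0 k; rewrite plane_coord_eval => /eqP->; rewrite scale0r.
Qed.

Section Divide.
Variables (t w : 'rV[K]_n).
Hypotheses (tL : forall u, u \in L -> ev (linform t) u = 0) (tw : ev (linform t) w = 1).
Hypothesis Lw : (<[w]> + L)%VS = fullv.

Lemma linform_divide a : (forall u, u \in L -> ev (linform a) u = 0) ->
  exists c, linform a = c *: linform t.
Proof.
move=> aL; exists (ev (linform a) w); apply/eqP; rewrite -subr_eq0 -linearZ -linearB.
apply/eqP/linform_eq0 => u; have : u \in fullv := memvf u.
rewrite -Lw => /memv_addP[_ /vlineP[b ->] [l lL ->]].
rewrite linform_evalD linform_evalZ linearB linearZ /= !mevalB !mevalZ.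
by rewrite tw (tL lL) (aL _ lL); ring.
Qed.

Lemma retract_divide D f : f \is D.+1.-homog ->
  exists2 h, h \is D.-homog & f - retract f = linform t * h.
Proof.
have XE i : exists c, 'X_i - retract 'X_i = c *: linform t.
  have -> : 'X_i - retract 'X_i =
      linform (delta_mx 0 i - \sum_k (tnth (vbasis L) k) 0 i *: plane_coord k).
    rewrite linearB /= linform_delta; congr (_ - _).
    rewrite /retract comp_mpolyXU -tnth_nth tnth_mktuple !raddf_sum /=.
    apply: eq_bigr => k _; rewrite comp_mpolyZ comp_mpolyXU -tnth_nth tnth_mktuple.
    by rewrite linearZ.
  apply: linform_divide => u uL; rewrite linearB /= mevalB linform_delta mevalXU.
  rewrite (raddf_sum (@linform K n)) (raddf_sum (meval _)) [in X in X - _](coord_vbasis uL).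
  rewrite summxE; apply/eqP; rewrite subr_eq0; apply/eqP; apply: eq_bigr => k _.
  by rewrite /= linearZ /= mevalZ plane_coord_eval mxE (tnth_nth 0) mulrC.
(* The induction starts in degree 0, where the difference is 0. Homogeneity is carried along because
   the quotient for ['X_i * g] contains a multiple of [g] itself. *)
suff : forall E f, f \is E.-homog -> f \is E.-homog /\
    if E is D'.+1 then exists2 h, h \is D'.-homog & f - retract f = linform t * h
    else f - retract f = 0.
  by move=> H /H[].
apply: dhomog_ind => [|E|E c g g' [hg Pg] [hg' Pg']|E i g [hg Pg]].
- by rewrite rmorph1 subrr dhomog1.
- rewrite dhomog0; split=> //; case: E => [|E]; first by rewrite rmorph0 subrr.
  by exists 0; [exact: dhomog0 | rewrite rmorph0 subrr mulr0].
- split; first by rewrite rpredD ?rpredZ.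
  rewrite raddfD /= /retract comp_mpolyZ comp_mpolyZ -!/(retract _).
  have -> : c *: g + g' - (c *: retract g + retract g') =
      c *: (g - retract g) + (g' - retract g') by rewrite scalerBr; ring.
  case: E Pg Pg' {hg hg'} => [|E]; first by move=> -> ->; rewrite scaler0 addr0.
  move=> [h hh ->] [h' hh' ->]; exists (c *: h + h'); first by rewrite rpredD ?rpredZ.
  by rewrite mulrDr scalerAr.
- split; first by rewrite -add1n dhomogM // dhomogX /= mdeg1.
  have [c cE] := XE i.
  have hX : retract 'X_i \is 1.-homog by rewrite retract_homog // dhomogX /= mdeg1.
  have -> : 'X_i * g - retract ('X_i * g) =
      ('X_i - retract 'X_i) * g + retract 'X_i * (g - retract g).
    by rewrite rmorphM /= mulrBl mulrBr addrA subrK.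
  rewrite cE; case: E hg Pg => [|E] hg.
    by move=> ->; exists (c *: g); [rewrite rpredZ | rewrite mulr0 addr0 -scalerAl scalerAr].
  move=> [h hh ->]; exists (c *: g + retract 'X_i * h).
    by rewrite rpredD ?rpredZ // -add1n dhomogM.
  by rewrite mulrDr -scalerAl scalerAr mulrCA.
Qed.
End Divide.

Variables (s : nat) (v : 'I_s -> 'rV[K]_n) (p : 'I_s -> {vspace 'rV[K]_n}).
Variables (m : 'I_s -> nat) (d N : nat).
Hypothesis v_neq0 : forall i, v i != 0.
Hypothesis pE : forall i, p i = <[v i]>%VS.

(* The sections F_k / x_k^N, where F_k interpolates the x_k^N g_i in the larger
   degree d + N, solve the problem locally on P(L); their differences form the
   cocycle to which the vanishing of H^1 is applied. *)
Lemma H1_restrict_interpolates : (1 < \dim L)%N -> interpolates v (d + N) m ->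
    H1_vanishes (restrict_ideal (L := L) (fat_ideal p m)) d ->
  forall g : 'I_s -> {mpoly K[n]}, (forall i, g i \is d.-homog) ->
  exists2 f, f \is d.-homog &
    forall i, v i \in L -> vanishing (v i) (m i) (f - retract (g i)).
Proof.
move=> dimL interp H1 g hg.
pose Y k := linform (plane_coord k).
have YX k : Y k \mPo rc = 'X_k := restrict_plane_coord k.
have hYN k D a h : h \is D.-homog -> Y k ^+ a * h \is (D + a).-homog.
  move=> hh; rewrite addnC dhomogM //.
  by have := dhomogMn a (linform_homog (plane_coord k)); rewrite mul1n.
(* The target is 0 off L, so that the differences defining the cocycle lie in the ideal at those
   points as well. *)
have Fk k : exists F, F \is (d + N).-homog /\
    forall i, vanishing (v i) (m i) (F - if v i \in L then Y k ^+ N * g i else 0).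
  have [|F hF vF] := interp (fun i => if v i \in L then Y k ^+ N * g i else 0).
    by move=> i; case: ifP => _; [apply: hYN | apply: dhomog0].
  by exists F.
have [F FP] := fin_all_exists Fk.
pose G k := F k \mPo rc.
have hG k : G k \is (d + N).-homog by apply: dhomog_comp restrict_coord_homog _; case: (FP k).
pose x k : {fraction {mpoly K[\dim L]}} := tofrac ('X_k ^+ N).
pose c k l := tofrac (G l) / x l - tofrac (G k) / x k.
have [k l|i j k|b bP bE] := H1 c; last 1 first.
- have [a aP] := fin_all_exists bP.
  have [u' uP] := fin_all_exists aP.
  have uP' k : exists u, fat_ideal p m u /\ u' k = u \mPo rc.
    by have [[u Iu uE] _ _] := uP k; exists u.
  have {uP'}[u Iu] := fin_all_exists uP'.
  pose A k := 'X_k ^+ a k * G k - 'X_k ^+ N * u' k.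
  have hA k : A k \is (d + (N + a k)).-homog.
    have [_ hu _] := uP k; move: hu; rewrite cards1 muln1 => hu.
    rewrite /A addnA; apply: rpredB; first by rewrite dhomog_XnM.
    by rewrite addnAC dhomog_XnM.
  have bk k : b k = tofrac (u' k) / tofrac ('X_k ^+ a k).
    by have [_ _ ->] := uP k; rewrite big_set1.
  have AE k : tofrac (A k) / tofrac ('X_k ^+ (N + a k)) = tofrac (G k) / x k - b k.
    by rewrite bk /x -tofrac_cech ?mpolyX_expD_neq0 // addnC exprD tofracM.
  pose k0 : 'I_(\dim L) := Ordinal (ltnW dimL); pose k1 := Ordinal dimL.
  (* As [c] is the coboundary of [b], the local sections minus [b] agree and form one global section
     on P(L). *)
  have q_const k : tofrac (A k) / tofrac ('X_k ^+ (N + a k)) =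
      tofrac (A k0) / tofrac ('X_k0 ^+ (N + a k0)).
    rewrite !AE; have := bE k0 k; rewrite /c => /eqP.
    by rewrite subr_eq => /eqP->; rewrite addrC -addrA addKr addrC.
  have cross k : 'X_k ^+ (N + a k) * A k0 = 'X_k0 ^+ (N + a k0) * A k.
    apply/eqP; rewrite -tofrac_eq !tofracM; apply/eqP/cross_mul => //.
    + by rewrite tofrac_eq0 mpolyX_expD_neq0.
    + by rewrite tofrac_eq0 mpolyX_expD_neq0.
  (* A fraction that can be written over a power of ['X_k0] and also over a power of ['X_k1] is a
     polynomial. *)
  have [phi phiE] := Xn_dvd_mul (isT : k1 != k0) (cross k1).
  have hphi : phi \is d.-homog by rewrite -(dhomog_XnM k0 (N + a k0)) -phiE.
  have AE' k : A k = 'X_k ^+ (N + a k) * phi.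
    apply: (mulfI (mpolyX_expD_neq0 K k0 (N + a k0))).
    by rewrite -cross phiE mulrCA.
  have hf : phi \mPo plane_coords \is d.-homog by apply: dhomog_comp plane_coords_homog hphi.
  exists (phi \mPo plane_coords) => // i iL.
  have [k ki] := plane_coord_neq0 (v_neq0 i) iL.
  apply: (vanishing_cancel (N := N + a k) ki (rpredB hf (retract_homog (hg i)))).
  have -> : linform (plane_coord k) ^+ (N + a k) * (phi \mPo plane_coords - retract (g i)) =
      Y k ^+ a k * retract (F k - Y k ^+ N * g i) - Y k ^+ N * retract (u k).
    have RY : 'X_k \mPo plane_coords = Y k by rewrite comp_mpolyXU -tnth_nth tnth_mktuple.
    have := congr1 (fun h => h \mPo plane_coords) (AE' k).
    rewrite /A (Iu k).2 rmorphB !rmorphM !rmorphXn /= RY -/(retract _) -/(retract (u k)).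
    rewrite mulrBr => <-; rewrite rmorphB rmorphM rmorphXn /= retract_plane_coord.
    exact: clear_error.
  apply: ideal_exp_B; apply: ideal_exp_Ml; apply: retract_vanishing => //.
    by have [_ /(_ i)] := FP k; rewrite iL.
  by have := (Iu k).1 i; rewrite pE.
- have [->|kl] := eqVneq k l.
    exists 0%N, 0; split; last by rewrite /c subrr rmorph0 mul0r.
      by exists 0; [move=> i; apply: ideal_exp_0 | rewrite rmorph0].
    exact: dhomog0.
  exists N, ('X_k ^+ N * G l - 'X_l ^+ N * G k); split.
  + exists (Y k ^+ N * F l - Y l ^+ N * F k); last first.
      by rewrite rmorphB !rmorphM !rmorphXn /= !YX.
    move=> i; rewrite pE; have [_ /(_ i)] := FP k; have [_ /(_ i)] := FP l.
    case: ifP => _; rewrite ?subr0 => vl vk; last by apply: ideal_exp_B; apply: ideal_exp_Ml.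
    have -> : Y k ^+ N * F l - Y l ^+ N * F k =
      Y k ^+ N * (F l - Y l ^+ N * g i) - Y l ^+ N * (F k - Y k ^+ N * g i) by ring.
    by apply: ideal_exp_B; apply: ideal_exp_Ml.
  + by rewrite cards2 kl muln2 -addnn addnA; apply: rpredB; rewrite dhomog_XnM.
  + by rewrite prod_set2 // exprMn tofracM tofrac_cech ?mpolyX_expD_neq0.
- by rewrite /c; apply: telescope3.
Qed.

End Restriction.

(** * Removal of a heavy plane *)

Section Extension.
Variables (K : fieldType) (vT : vectType K).

Lemma span_notin (U : {vspace vT}) : (\dim U < dim vT)%N -> exists w, w \notin U.
Proof.
rewrite -dimvf => dU; have /negP nU : ~~ (fullv <= U)%VS.
  by apply: contraL dU => /dimvS; rewrite leqNgt.
apply: NNPP => nex; case: nU; apply/subvP => w _.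
by apply: NNPP => /negP wU; apply: nex; exists w.
Qed.

Lemma dim_add_line w (U : {vspace vT}) : w \notin U -> \dim (<[w]> + U) = (\dim U).+1.
Proof.
move=> wU; have := @dim_span_cons _ _ w (vbasis U).
by rewrite span_cons (span_basis (vbasisP U)); apply.
Qed.

Lemma extend_vspace r (U : {vspace vT}) : (\dim U <= r <= dim vT)%N ->
  exists2 W : {vspace vT}, (U <= W)%VS & \dim W = r.
Proof.
case/andP=> dU; rewrite -(subnKC dU); elim: (r - \dim U)%N => [|N IHN] leN.
  by exists U; rewrite ?subvv ?addn0.
rewrite addnS in leN; have [W UW dW] := IHN (ltnW leN).
have [|w wW] := @span_notin W; first by rewrite dW.
by exists (<[w]> + W)%VS; rewrite ?dim_add_line ?dW ?addnS // (subv_trans UW) ?addvSr.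
Qed.

End Extension.

Section HeavyResidual.
Variables (K : fieldType) (vT : vectType K) (s d : nat) (v : 'I_s -> vT) (m : 'I_s -> nat).
Implicit Types L U W : {vspace vT}.
Hypothesis v_neq0 : forall i, v i != 0.
Hypothesis wT : (wt v m fullv <= 3 * d.+1 + 1)%N.
Hypothesis wL : forall U, (\dim U <= 2)%N -> (wt v m U <= d.+1 + 1)%N.
Hypothesis wH : forall W, (\dim W <= 3)%N -> (wt v m W <= 2 * d.+1 + 2)%N.

(** L contains three independent points, so the total, and any plane containing L, drops by 3. A
    line meeting the support in L drops by 1; any other line weighs at most (3d + 4) - (2d + 4) = d.
    A plane not containing L meets it in weight at most d + 2, so it weighs at most 2d + 2, and it
    drops by 1 unless that weight is 0, when it weighs at most d. *)
Lemma heavy_residual L : (\dim L <= 3)%N -> wt v m L = (2 * d.+1 + 2)%N ->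
  [/\ (wt v (cut v m L) fullv <= 3 * d + 1)%N,
      forall U, (\dim U <= 2)%N -> (wt v (cut v m L) U <= d + 1)%N
    & forall W, (\dim W <= 3)%N -> (wt v (cut v m L) W <= 2 * d + 1)%N].
Proof.
move=> dL L_heavy.
have [|x [mx xL x0]] := @wt_exists _ _ _ v m L 0%VS.
  by rewrite L_heavy (leq_ltn_trans (wL _)) ?dimv0 //; lia.
have [|y [my yL yx]] := @wt_exists _ _ _ v m L <<[:: v x]>>.
  by rewrite L_heavy (leq_ltn_trans (wL _)) ?(leq_trans (dim_span _)) //; lia.
have [|z [mz zL zyx]] := @wt_exists _ _ _ v m L <<[:: v y; v x]>>.
  by rewrite L_heavy (leq_ltn_trans (wL _)) ?dim_span //; lia.
have yNx : y != x by apply: contra yx => /eqP->; in_span.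
have zNx : z != x by apply: contra zyx => /eqP->; in_span.
have zNy : z != y by apply: contra zyx => /eqP->; in_span.
have cut3 W : v x \in W -> v y \in W -> v z \in W -> (wt v (cut v m L) W + 3 <= wt v m W)%N.
  move=> xW yW zW; apply: (@wt_cut _ _ _ _ _ _ _ [:: z; y; x]) => [|i].
    by rewrite /= !inE negb_or zNy zNx yNx.
  by rewrite !inE => /or3P[]/eqP->.
have cut1 W : (0 < wt v m (L :&: W))%N -> (wt v (cut v m L) W < wt v m W)%N.
  move=> gt0; have [|i [mi]] := @wt_exists _ _ _ v m (L :&: W) 0%VS.
    rewrite /wt big1 // => i; rewrite memv0 => /eqP vi.
    by have := v_neq0 i; rewrite vi eqxx.
  rewrite memv_cap => /andP[iL iW] _; rewrite -addn1.
  by apply: (@wt_cut _ _ _ _ _ _ _ [:: i]) => // j; rewrite inE => /eqP->.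
have capLe W := wt_cap_le v m (subvf L) (subvf W).
split=> [|U dU|W dW].
- by have := cut3 fullv (memvf _) (memvf _) (memvf _); arith.
- have := capLe U; have := wL dU; have := wt_cut_le v m L U; have := cut1 U.
  by case: (posnP (wt v m (L :&: U))) => [-> _|gt0 /(_ isT)]; arith.
have [/subvP sLW|nLW] := boolP (L <= W)%VS.
  by have := cut3 W (sLW _ xL) (sLW _ yL) (sLW _ zL); have := wH dW; arith.
have := capLe W; have := wt_cut_le v m L W; have := cut1 W.
have : (wt v m (L :&: W) <= d.+1 + 1)%N.
  by apply: wL; rewrite -ltnS; apply: leq_trans (dim_cap_lt nLW) dL.
by case: (posnP (wt v m (L :&: W))) => [-> _ _|gt0 capW /(_ isT)]; arith.
Qed.

(** Only weight d is left off L. The stated bound is what [vanishing_divide] needs to divide a jet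
    by the equation of L with quotient of degree d. *)
Lemma heavy_outside L i : wt v m L = (2 * d.+1 + 2)%N -> v i \notin L -> (m i <= d.+1)%N.
Proof.
move=> L_heavy iL.
have mi : (m i <= outside v m L)%N by rewrite /outside (bigD1 i) //= leq_addr.
by have := wt_outside v m L; arith.
Qed.

End HeavyResidual.

Section Residual.
Variables (K : closedFieldType) (n s d : nat) (v : 'I_s -> 'rV[K]_n) (m : 'I_s -> nat).
Variable L : {vspace 'rV[K]_n}.
Implicit Types U W : {vspace 'rV[K]_n}.
Hypotheses (v_neq0 : forall i, v i != 0) (v_inj : forall i j, v i \in <[v j]>%VS -> i = j).
Hypothesis wT : (wt v m fullv <= 3 * d.+1 + 1)%N.
Hypothesis wL : forall U, (\dim U <= 2)%N -> (wt v m U <= d.+1 + 1)%N.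
Hypothesis wH : forall W, (\dim W <= 3)%N -> (wt v m W <= 2 * d.+1 + 2)%N.
Hypothesis L_heavy : wt v m L = (2 * d.+1 + 2)%N.

Lemma residual_interpolates : (\dim L <= 3)%N -> interpolates v d (cut v m L).
Proof.
move=> dL; have [cT cL cH] := heavy_residual v_neq0 wT wL wH dL L_heavy.
exact: segre_interpolates.
Qed.

(** Residual sequence of L, with equation [t]. The form [f] solves the problem on L, so at every
    point the error is [t] times some [h i] up to the required order: on L because
    [g i - retract L (g i)] is divisible by [t], off L because [t] is a unit. The [h i] are then
    interpolated on the residual in degree d. *)
Lemma heavy_plane_interpolates : \dim L = 3%N -> n = 4%N ->
  (forall g : 'I_s -> {mpoly K[n]}, (forall i, g i \is d.+1.-homog) ->
    exists2 f, f \is d.+1.-homog &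
      forall i, v i \in L -> vanishing (v i) (m i) (f - retract L (g i))) ->
  interpolates v d.+1 m.
Proof.
move=> dL n4 interpL g hg; have [f hf vf] := interpL g hg.
have dn : dim 'rV[K]_n = 4%N by rewrite -n4 /dim /= mul1n.
have [|w wNL] := @span_notin _ _ L; first by rewrite dL dn.
have [t [tL tw]] := separating_linform wNL.
have Lw : (<[w]> + L)%VS = fullv.
  by apply/eqP; rewrite eqEdim subvf dimvf dim_add_line // dL dn.
have hP i : exists h, h \is d.-homog /\ vanishing (v i) (m i) (f - g i - linform t * h).
  have [iL|iL] := boolP (v i \in L).
    have [h hh hE] := retract_divide tL tw Lw (hg i).
    exists (- h); split; first by rewrite rpredN.
    have -> : f - g i - linform t * - h = f - retract L (g i).
      by rewrite mulrN -hE; ring.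
    exact: vf.
  have ti : ev (linform t) (v i) != 0.
    have : v i \in fullv := memvf _; rewrite -Lw => /memv_addP[_ /vlineP[a ->] [l lL viE]].
    rewrite viE linform_evalD linform_evalZ tw (tL _ lL) mulr1 addr0.
    by apply: contra iL => /eqP a0; rewrite viE a0 scale0r add0r.
  have [||h hh vh] := @vanishing_divide _ _ (v i) t d 1 (m i) (f - g i) ti.
  - by rewrite addn1; apply: rpredB hf (hg i).
  - by apply: (heavy_outside wT L_heavy).
  by exists h; rewrite expr1 in vh.
have [h hh] := fin_all_exists hP.
have [|f' hf' vf'] := residual_interpolates _ (fun i => (hh i).1); first by rewrite dL.
exists (f - linform t * f').
  by apply: (rpredB hf); rewrite -add1n dhomogM ?linform_homog.
move=> i; have -> : f - linform t * f' - g i =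
    (f - g i - linform t * h i) - linform t * (f' - h i) by ring.
by apply: ideal_exp_B; [case: (hh i) | apply: vanishing_cut tL (vf' i)].
Qed.

End Residual.

Local Close Scope ring_scope.

Theorem proposition4p5 (K : closedFieldType) (d s : nat)
    (p : 'I_s -> {vspace 'rV[K]_4}) (m : 'I_s -> nat) :
  2 <= d ->
  (forall i, \dim (p i) = 1) ->
  injective p ->
  (forall i, 0 < m i) ->
  weight m <= 3 * d + 1 ->
  (forall L : {vspace 'rV[K]_4}, \dim L = 2 -> weight_on p m L <= d + 1) ->
  (forall L : {vspace 'rV[K]_4}, \dim L = 3 ->
     weight_on p m L <= 2 * d + 2 /\
     (weight_on p m L = 2 * d + 2 ->
      H1_vanishes (restrict_ideal (L := L) (fat_ideal p m)) d)) ->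
  H1_vanishes (fat_ideal p m) d.
Proof.
move=> d_ge2 p1 p_inj _ wT wL wH.
pose v i := vpick (p i).
have v_neq0 i : v i != 0%R by rewrite vpick0 -dimv_eq0 p1.
have pE i : p i = <[v i]>%VS.
  by apply/esym/eqP; rewrite eqEdim -memvE memv_pick p1 dim_vline v_neq0.
have v_inj i j : v i \in <[v j]>%VS -> i = j.
  rewrite -pE memvE -pE => sij; apply: p_inj; apply/eqP.
  by rewrite eqEdim sij !p1.
have wtT : wt v m fullv = weight m by apply: eq_bigl => i; rewrite memvf.
have wtE W : wt v m W = weight_on p m W by apply: eq_bigl => i; rewrite pE memvE.
rewrite -wtT in wT.
have dim4 : dim 'rV[K]_4 = 4 by [].
(* The hypotheses concern lines and planes exactly, whereas the spans and intersections used above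
   may be smaller. *)
have wL' (U : {vspace 'rV[K]_4}) : (\dim U <= 2) -> (wt v m U <= d + 1).
  move=> dU; have [|W UW dW] := @extend_vspace _ _ 2 U; first by rewrite dU dim4.
  by apply: leq_trans (wt_sub v m UW) _; rewrite wtE wL.
have wH' (U : {vspace 'rV[K]_4}) : (\dim U <= 3) -> (wt v m U <= 2 * d + 2).
  move=> dU; have [|W UW dW] := @extend_vspace _ _ 3 U; first by rewrite dU dim4.
  by apply: leq_trans (wt_sub v m UW) _; rewrite wtE; case: (wH W dW).
have md i : (m i <= d.+1).
  have := wL' <[v i]>%VS; rewrite dim_vline v_neq0 addn1 => /(_ isT); apply: leq_trans.
  exact: wt_ge (memv_line _).
apply: (interpolates_H1 v_neq0 pE) => //.
have [[L [dL heavy]]|light] := classic (exists L : {vspace 'rV[K]_4},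
    \dim L = 3 /\ wt v m L = (2 * d + 2)); last first.
  apply: segre_interpolates => // W dW; rewrite -ltnS -addnS ltn_neqAle wH' // andbT.
  apply/eqP => heavy; apply: light.
  have [|W' WW' dW'] := @extend_vspace _ _ 3 W; first by rewrite dW dim4.
  exists W'; split=> //; apply/eqP; rewrite eqn_leq wH' ?dW' //.
  by rewrite -heavy wt_sub.
case: d d_ge2 wT wL' wH' md heavy wL wH => // d _ wT wL' wH' md heavy wL wH.
apply: (heavy_plane_interpolates v_neq0 v_inj wT wL' wH' heavy dL) => // g.
(* In degree [d.+1 + weight m] each of the Segre bounds exceeds the total weight, so the auxiliary
   interpolation is automatic. *)
apply: (H1_restrict_interpolates (p := p) (N := weight m)) => //.
- by rewrite dL.
- have wN (U : {vspace 'rV[K]_4}) N : (weight m <= N) -> (wt v m U <= N).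
    by apply: leq_trans; rewrite -wtT wt_sub ?subvf.
  by apply: segre_interpolates => // [|U _|U _]; apply: wN; lia.
- by have [_] := wH L dL; apply; rewrite -wtE.
Qed.
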